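(* Let $m \geq 2$, let $D \subset \mathbb{R}^m$ be a domain, and let $u \in C^2(D)$ be harmonic in $D$. Then for every $x \in D$ and every $r > 0$ with $\overline{B_r(x)} \subset D$, \[ (m\,\alpha^{-1} - 1)\, r^{\alpha - m}\, u(x) = \frac{1}{|B_r|} \int_{B_r(x)} u(y) \left[ |x-y|^{\alpha-m} - r^{\alpha-m} \right] \mathrm{d}y \quad \text{for every } \alpha \in (0,m), \] and \[ \left[ 1 - \frac{m}{m+\beta} \right] r^\beta\, u(x) = \frac{1}{|B_r|} \int_{B_r(x)} u(y) \left[ r^\beta - |x-y|^\beta \right] \mathrm{d}y \quad \text{for every } \beta > 0 . \] Moreover, for any $x \in \mathbb{R}^m$, $r>0$, $\alpha \in (0,m)$ and $\beta>0$, both functions $y \mapsto |x-y|^{\alpha-m} - r^{\alpha-m}$ and $y \mapsto r^\beta - |x-y|^\beta$ are integrable over any bounded domain.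
   Context: $B_r(x) = \{y : |y-x| < r\}$ and $|B_r|$ denotes its Lebesgue measure. *)

(* Defs.v *)
From HB Require Import structures.
From mathcomp Require Import all_boot all_order all_algebra.
From mathcomp Require Import all_classical all_reals all_analysis.
Import Order.TTheory GRing.Theory Num.Theory.
Import numFieldNormedType.Exports.

Set Implicit Arguments.
Unset Strict Implicit.
Unset Printing Implicit Defensive.

Local Open Scope classical_set_scope.
Local Open Scope ring_scope.

Section Defs.
Variable R : realType.

(* m-dimensional Lebesgue measure, built on m.-tuple R (equipped with  *)
(* the product sigma-algebra of Borel sets of R) as the iterated       *)
(* product of the one-dimensional Lebesgue measure.                    *)

Definition tcons n (p : (n.-tuple R * measurableTypeR R)%type) : n.+1.-tuple R :=
  [tuple of p.2 :: p.1].

Lemma measurable_tcons n :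
  measurable_fun [set: (n.-tuple R * measurableTypeR R)%type] (@tcons n).
Proof. apply: measurable_cons; [exact: measurable_snd | exact: measurable_fst]. Qed.

Fixpoint lebn (n : nat) : {measure set (n.-tuple R) -> \bar R} :=
  match n with
  | 0 => [the measure _ _ of @dirac _ _ [tuple] R]
  | k.+1 => measure_function_pushforward__canonical__measure_function_Measure
              (lebn k \x (@lebesgue_measure R))%E (@measurable_tcons k)
  end.

Definition row_of n (t : n.-tuple R) : 'rV[R]_n := \row_(i < n) tnth t i.

Definition enorm n (v : 'rV[R]_n) : R := Num.sqrt (\sum_(i < n) v ord0 i ^+ 2).

Definition eball n (x : 'rV[R]_n) (r : R) : set 'rV[R]_n :=
  [set y | enorm (y - x) < r].

Definition ball_vol n (r : R) : R :=
  fine (lebn n [set t | eball 0 r (row_of t)]).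

Definition is_domain n (D : set 'rV[R]_n) : Prop :=
  D !=set0 /\ open D /\ connected D.

Definition partial n (i : 'I_n) (f : 'rV[R]_n -> R) : 'rV[R]_n -> R :=
  fun x => 'D_(delta_mx ord0 i) f x.

Definition C2_on n (D : set 'rV[R]_n) (f : 'rV[R]_n -> R) : Prop :=
  forall x, D x ->
    {for x, continuous f} /\
    forall i : 'I_n,
      derivable f x (delta_mx ord0 i) /\ {for x, continuous (partial i f)} /\
      forall j : 'I_n,
        derivable (partial i f) x (delta_mx ord0 j) /\
        {for x, continuous (partial j (partial i f))}.

Definition is_harmonic n (D : set 'rV[R]_n) (u : 'rV[R]_n -> R) : Prop :=
  C2_on D u /\ forall x, D x -> \sum_(i < n) partial i (partial i u) x = 0.

End Defs.
Arguments lebn {R} n.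

(* Main.v *)
(** The divergence theorem is avoided.  On a chord of the unit ball parallel to the i-th axis,
    [d_i v (y) y_i + d_i d_i v (y) (|y|^2 - 1) / 2] is the derivative of
    [d_i v (y) (|y|^2 - 1) / 2], which vanishes at both ends; so it integrates to 0, and summing
    over [i] gives [\int_{|y| < 1} grad v (y) . y dy = 0] for every harmonic [v].  Applied to
    [v (y) = u (x + l y)] and integrated in [l], this yields the mean value property on solid balls.
    For [p > - m], write [r^p - |x - y|^p] as the integral of [p s^(p - 1)] over [|x - y| < s < r]
    and exchange the integrals: only ball means of [u] remain, and
    [\int_{B_r} u(y) (r^p - |x - y|^p) dy = p / (p + m) r^p |B_r| u(x)].  The two formulas are
    the cases [p = a - m] and [p = b]. *)
Require Import Defs.
From HB Require Import structures.
From mathcomp Require Import all_boot all_order all_algebra.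
From mathcomp Require Import all_classical all_reals all_analysis.
From mathcomp Require Import measurable_realfun ring lra.
Import Order.TTheory GRing.Theory Num.Theory.
Import numFieldNormedType.Exports.
Set Implicit Arguments.
Unset Strict Implicit.
Unset Printing Implicit Defensive.
Local Open Scope classical_set_scope.
Local Open Scope ring_scope.

(** Behind the chord computation is an integration by parts of [grad v . grad w] with
    [w (y) = (|y|^2 - 1) / 2]: the gradient of [w] is [y] and [w] vanishes on the unit sphere, so
    neither a boundary term nor a surface measure appears. Cutting the ball into chords needs only
    Fubini and the one-dimensional fundamental theorem, which suits a measure built as an iterated
    product. Two points shape the rest. [C2_on] speaks of derivatives along the axes only, so
    differentiability of [u] along an arbitrary line has to be derived from the continuity of the
    partial derivatives. And [u] is controlled only in [D], so functions are extended by zero with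
    [\_ D] to be measurable everywhere, while compactness of the closed ball bounds them there. The
    condition [p > - m] makes [s^(p + m - 1)] integrable at 0, hence the exchange of integrals
    absolutely convergent. *)

Section measurability.
Variable R : realType.

(** * Measurability on tuples: boxes, open sets, continuous functions, the Euclidean norm *)

Definition tbox n (A : 'I_n -> set R) : set (n.-tuple R) :=
  [set t | forall i, A i (tnth t i)].

Lemma measurable_tbox n (A : 'I_n -> set R) :
  (forall i, measurable (A i)) -> measurable (tbox A).
Proof.
move=> mA.
have -> : tbox A = \bigcap_(i in [set: 'I_n]) ((@tnth n R ^~ i) @^-1` A i).
  by apply/seteqP; split => [t At i _|t At i]; [exact: At|exact: (At i I)].
apply: fin_bigcap_measurable; first exact: finite_finset.
by move=> i _; rewrite -[X in measurable X]setTI; exact: measurable_tnth.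
Qed.

(** The norm on row vectors is the sup norm, so its balls are boxes; an open set is the union of the
    boxes with rational centre and radius [1 / (k + 1)] that it contains, and these are countably
    many. *)
Lemma measurable_row_open n (A : set 'rV[R]_n) :
  open A -> measurable [set t : n.-tuple R | A (row_of t)].
Proof.
move=> oA.
pose B (p : n.-tuple rat * nat) : set (n.-tuple R) :=
  tbox (fun i => ball (ratr (tnth p.1 i) : R) p.2.+1%:R^-1).
pose U := {p : n.-tuple rat * nat | `[< B p `<=` [set t | A (row_of t)] >]}.
have -> : [set t : n.-tuple R | A (row_of t)] = \bigcup_(p : U) B (val p).
  apply/seteqP; split; last by move=> t [[p /= /asboolP pA] _ /pA].
  move=> t /= At.
  have /nbhs_ballP[e /= e0 eA] : nbhs (row_of t) A by exact: open_nbhs_nbhs.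
  (* Half of [e] is for the distance from [t] to a rational centre, half for the radius of the box
     around that centre. *)
  have [k ke] : exists k : nat, k.+1%:R^-1 < e / 2 :> R.
    have e20 : 0 < e / 2 by rewrite divr_gt0.
    exists (Num.trunc (e / 2)^-1); rewrite invf_plt ?posrE//.
    by apply: Num.Theory.truncnS_gt.
  have qP (i : 'I_n) : exists q : rat, ball (tnth t i) (k.+1%:R^-1 : R) (ratr q).
    have k0 : 0 < k.+1%:R^-1 :> R by rewrite invr_gt0.
    have itv0 : tnth t i - k.+1%:R^-1 < tnth t i + k.+1%:R^-1.
      by rewrite ltrBlDr -addrA ltrDl addr_gt0.
    have [q] := rat_in_itvoo itv0.
    by rewrite in_itv/= => qi; exists q; rewrite /ball/= ltr_distlC.
  have [q qE] := choice qP.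
  have pA : `[< B ([tuple q i | i < n], k) `<=` [set t | A (row_of t)] >].
    apply/asboolP => s /= Bs; apply: eA; split => // i j; rewrite !mxE.
    have := Bs j; have := qE j; rewrite tnth_mktuple /ball/= => h1 h2.
    have -> : tnth t j - tnth s j = (tnth t j - ratr (q j)) + (ratr (q j) - tnth s j) by ring.
    apply: le_lt_trans (ler_normD _ _) _.
    rewrite (splitr e) ltrD// (lt_trans _ ke)// distrC.
  exists (exist (fun p => `[< B p `<=` [set t | A (row_of t)] >]) _ pA : U) => // i /=.
  rewrite tnth_mktuple.
  by apply: ball_sym.
apply: countable_bigcupT_measurable; first exact: countableP.
move=> [[q k] _] /=; apply: measurable_tbox => i.
by apply: open_measurable; exact: ball_open.
Qed.

Lemma measurable_row_continuous n (D : set 'rV[R]_n) (f : 'rV[R]_n -> R) :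
  open D -> (forall x, D x -> {for x, continuous f}) ->
  measurable_fun setT (fun t : n.-tuple R => (f \_ D) (row_of t)).
Proof.
move=> oD cf.
have -> : (fun t : n.-tuple R => (f \_ D) (row_of t)) =
   (fun t => f (row_of t)) \_ [set t | D (row_of t)].
  by apply/funext => t; rewrite !patchE; congr (if _ then _ else _); apply/idP/idP; rewrite !inE.
have mD := measurable_row_open oD.
apply/(measurable_restrictT _ mD).
apply: (measurability _ (RGenOpens.measurableE R)) => // _ [_ [a [b ->]] <-].
have -> : [set t | D (row_of t)] `&` (fun t => f (row_of t)) @^-1` `]a, b[ =
   [set t : n.-tuple R | (D `&` f @^-1` `]a, b[) (row_of t)] by [].
apply: measurable_row_open.
rewrite openE => x [/= Dx fx].
apply: filterI; first by apply: open_nbhs_nbhs.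
by apply: (cf _ Dx); apply: open_nbhs_nbhs; split => //; exact: interval_open.
Qed.

Lemma measurable_row_coord n (i : 'I_n) :
  measurable_fun setT (fun t : n.-tuple R => row_of t ord0 i).
Proof. under eq_fun do rewrite mxE; exact: measurable_tnth. Qed.

Lemma measurable_enorm n (x : 'rV[R]_n) :
  measurable_fun setT (fun t : n.-tuple R => enorm (row_of t - x)).
Proof.
rewrite /enorm.
apply: (measurableT_comp (f := @Num.sqrt R)).
  apply: continuous_measurable_fun; exact: sqrt_continuous.
apply: measurable_sum => i.
apply: measurable_funX.
under eq_fun do rewrite !mxE.
by apply: measurable_funB => //; exact: measurable_tnth.
Qed.

Lemma enormN n (v : 'rV[R]_n) : enorm (- v) = enorm v.
Proof. by rewrite /enorm; under eq_bigr do rewrite mxE sqrrN. Qed.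

Lemma enormZ n (a : R) (v : 'rV[R]_n) : enorm (a *: v) = `|a| * enorm v.
Proof.
rewrite /enorm; under eq_bigr do rewrite mxE exprMn.
by rewrite -mulr_sumr sqrtrM ?sqr_ge0// sqrtr_sqr.
Qed.

Lemma enorm_ge0 n (v : 'rV[R]_n) : 0 <= enorm v.
Proof. exact: sqrtr_ge0. Qed.

Lemma enorm_sqr n (v : 'rV[R]_n) : enorm v ^+ 2 = \sum_i v ord0 i ^+ 2.
Proof. by rewrite sqr_sqrtr// sumr_ge0// => i _; rewrite sqr_ge0. Qed.

Lemma enorm_coord n (v : 'rV[R]_n) i : `|v ord0 i| <= enorm v.
Proof.
rewrite -ler_sqr ?nnegrE ?enorm_ge0// enorm_sqr real_normK ?num_real//.
by rewrite (bigD1 i)//= lerDl sumr_ge0// => j _; rewrite sqr_ge0.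
Qed.

Lemma measurable_eball n (x : 'rV[R]_n) r :
  measurable [set t : n.-tuple R | eball x r (row_of t)].
Proof.
rewrite -[X in measurable X]setTI.
have -> : [set t : n.-tuple R | eball x r (row_of t)] =
   (fun t => enorm (row_of t - x)) @^-1` `]-oo, r[.
  by apply/seteqP; split => t; rewrite /= /eball/= in_itv.
exact: measurable_enorm.
Qed.

End measurability.

(** * The measure [lebn]: uniqueness on boxes, slicing along any axis, affine maps *)

Section lebn_measure.
Variable R : realType.
Local Notation lam := (@lebesgue_measure R).

Lemma tcons_tbox n (A : 'I_n.+1 -> set R) :
  @tcons R n @^-1` tbox A = tbox (A \o lift ord0) `*` A ord0.
Proof.
apply/seteqP; split => [[t s] /= At|[t s] /= [At As] i].
  split; last by have := At ord0; rewrite tnth0.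
  by move=> i /=; have := At (lift ord0 i); rewrite tnthS.
case: (unliftP ord0 i) => [j ->|->]; last by rewrite tnth0.
by rewrite tnthS; exact: At.
Qed.

Lemma lebn_tbox n (A : 'I_n -> set R) : (forall i, measurable (A i)) ->
  lebn n (tbox A) = (\prod_(i < n) lam (A i))%E.
Proof.
elim: n A => [|n ih] A mA.
  rewrite big_ord0 /= diracE mem_set//.
  by case.
rewrite big_ord_recl /= /pushforward tcons_tbox product_measure1E//.
  by rewrite ih 1?muleC// => i; exact: mA.
- by apply: measurable_tbox => i; exact: mA.
- exact: mA.
Qed.

(** The sigma-algebra comes generated by cylinders over a single coordinate, which are not stable
    under intersection; boxes are, as uniqueness of measures requires. *)
Lemma measurable_tuple_tbox n :
  @measurable _ (n.-tuple R) =
  <<s [set tbox A | A in [set A : 'I_n -> set R | forall i, measurable (A i)]] >>.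
Proof.
apply/seteqP; split.
  apply: smallest_sub; first exact: smallest_sigma_algebra.
  move=> X; rewrite -bigcup_seq => -[i /= _ [B mB <-]].
  apply: sub_sigma_algebra.
  exists (fun j => if j == i then B else setT).
    by move=> j; case: ifP.
  rewrite setTI; apply/seteqP; split => t /=.
    by move=> /(_ i); rewrite eqxx.
  by move=> Bt j; case: ifPn => [/eqP ->|].
apply: smallest_sub; first exact: sigma_algebra_measurable.
by move=> _ [A mA <-]; exact: measurable_tbox.
Qed.

Let cube n k : set (n.-tuple R) := tbox (fun=> `]- (k%:R : R), (k%:R : R)[%classic).

Let cube_cover n : \bigcup_k @cube n k = setT.
Proof.
apply/seteqP; split => // t _.
exists (\max_(i < n) (Num.trunc `|tnth t i|).+1)%N => //= i.
rewrite /mkset in_itv/= -ltr_norml; apply: lt_le_trans (Num.Theory.truncnS_gt _) _.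
by rewrite ler_nat; apply: (leq_bigmax i).
Qed.

Let cube_fin n k : (lebn n (@cube n k) < +oo)%E.
Proof.
rewrite lebn_tbox//.
suff /fin_numPlt/andP[] :
  (\prod_(i < n) lam (`]- (k%:R : R), (k%:R : R)[%classic)%R)%E \is a fin_num by [].
apply: prode_fin_num => i _ /=.
by rewrite lebesgue_measure_itv/=; case: ifP.
Qed.

(** Through this, changes of variables for [lebn] reduce to a computation on boxes; the cubes
    [cube n k] supply the exhaustion by sets of finite measure. *)
Lemma lebn_unique n (mu : {measure set (n.-tuple R) -> \bar R}) :
  (forall A : 'I_n -> set R, (forall i, measurable (A i)) ->
     mu (tbox A) = (\prod_(i < n) lam (A i))%E) ->
  forall X, measurable X -> lebn n X = mu X.
Proof.
move=> muE X mX; apply: (measure_unique _ (@cube n) (measurable_tuple_tbox n)) => //.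
- move=> _ _ [A mA <-] [B mB <-]; exists (fun i => A i `&` B i).
    by move=> i; exact: measurableI.
  apply/seteqP; split => [t /= ABt|t /= [At Bt] i]; last by split.
  by split => i; case: (ABt i).
- by move=> k; eexists; last reflexivity.
- exact: cube_cover.
- by move=> _ [A mA <-]; rewrite muE// lebn_tbox.
- exact: cube_fin.
Qed.

Lemma lebn_sigma_finite n : sigma_finite setT (lebn n : {measure set (n.-tuple R) -> \bar R}).
Proof.
exists (@cube n); first by rewrite cube_cover.
by move=> k; split; [exact: measurable_tbox|exact: cube_fin].
Qed.

(* A convertible copy of [lebn n]: the sigma-finite structure cannot be attached to [lebn n],
   which is itself the projection of a packed measure. *)
Definition lebsf n : set (n.-tuple R) -> \bar R := lebn n.

HB.instance Definition _ n := isMeasure.Build _ _ _ (@lebsf n)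
  (measure0 (lebn n)) (measure_ge0 (lebn n)) (@measure_semi_sigma_additive _ _ _ (lebn n)).

HB.instance Definition _ n := Measure_isSigmaFinite.Build _ _ _ (@lebsf n)
  (@lebn_sigma_finite n).

(** The construction of [lebn] splits off the first coordinate only; inserting at position [i] lets
    chords parallel to any axis be the inner variable of integration. *)
Definition tins n (i : 'I_n.+1) (p : (n.-tuple R * measurableTypeR R)%type) : n.+1.-tuple R :=
  [tuple if unlift i j is Some k then tnth p.1 k else p.2 | j < n.+1].

Lemma measurable_tins n i : measurable_fun setT (@tins n i).
Proof.
apply/measurable_fun_tnthP => j /=; rewrite /comp.
under eq_fun do rewrite tnth_mktuple.
case: (unlift i j) => [k|]; last exact: measurable_snd.
by apply: (measurableT_comp (f := @tnth n R ^~ k)); [exact: measurable_tnth|exact: measurable_fst].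
Qed.

Lemma tins_tbox n i (A : 'I_n.+1 -> set R) :
  @tins n i @^-1` tbox A = tbox (A \o lift i) `*` A i.
Proof.
apply/seteqP; split => [[t s] /= At|[t s] /= [At As] j].
  split; last by have := At i; rewrite tnth_mktuple unlift_none.
  by move=> j /=; have := At (lift i j); rewrite tnth_mktuple liftK.
by rewrite tnth_mktuple; case: (unliftP i j) => [k ->|->] //; exact: At.
Qed.

(** On boxes both sides are the same product of lengths, up to the order of the factors. *)
Lemma lebn_tins n i (X : set (n.+1.-tuple R)) : measurable X ->
  lebn n.+1 X = pushforward (@lebsf n \x lam)%E (@tins n i) X.
Proof.
apply: (@lebn_unique _ (measure_function_pushforward__canonical__measure_function_Measure
  (@lebsf n \x lam)%E (measurable_tins i))) => A mA.
rewrite /= /pushforward tins_tbox product_measure1E//; last 2 first.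
  by apply: measurable_tbox => j; exact: mA.
  exact: mA.
rewrite /lebsf lebn_tbox; last by move=> j; exact: mA.
rewrite [RHS](bigD1 i)//= muleC; congr (_ * _)%E.
(* The inverse of [lift i] needs a default value [ord0], so the case of no remaining coordinate is
   treated apart. *)
clear X; case: n i A mA => [|n] i A mA.
  rewrite big_ord0 big_pred0// => j; by rewrite (ord1 i) (ord1 j).
rewrite [RHS](reindex (lift i)); last first.
  exists (fun j => odflt ord0 (unlift i j)) => j.
    by rewrite liftK.
  by rewrite inE; case: (unliftP i j) => [k ->|->]; rewrite ?liftK ?eqxx.
by apply: eq_big => // j; rewrite eq_sym neq_lift.
Qed.

Definition taff n (c : 'rV[R]_n) (a : R) (t : n.-tuple R) : n.-tuple R :=
  [tuple c ord0 i + a * tnth t i | i < n].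

Lemma row_of_taff n (c : 'rV[R]_n) a t : row_of (taff c a t) = c + a *: row_of t.
Proof. by apply/rowP => i; rewrite !mxE tnth_mktuple. Qed.

Lemma measurable_taff n (c : 'rV[R]_n) a : measurable_fun setT (taff c a).
Proof.
apply/measurable_fun_tnthP => j /=; rewrite /comp.
under eq_fun do rewrite tnth_mktuple.
by apply: measurable_funD => //; apply: measurable_funM => //; exact: measurable_tnth.
Qed.

Lemma measurable_affine (c a : R) :
  measurable_fun setT (fun s : measurableTypeR R => c + a * s : measurableTypeR R).
Proof. by apply: measurable_funD => //; apply: measurable_funM. Qed.

(** Half-open intervals determine [lam], and [mu], the push-forward under [s -> c + a s] scaled by
    [a], gives them their length. *)
Lemma lebesgue_measure_affine (c a : R) (A : set R) : 0 < a -> measurable A ->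
  lam ((fun s => c + a * s) @^-1` A) = (a^-1%:E * lam A)%E.
Proof.
move=> a0 mA.
have a10 : 0 <= a by exact: ltW.
pose mu := [the measure _ _ of mscale (NngNum a10)
  (measure_function_pushforward__canonical__measure_function_Measure lam
    (measurable_affine c a))].
have -> : lam A = mu A.
  apply: (@lebesgue_measure_unique R mu) => // _ [[x y] _ <-].
  rewrite /mu /= /mscale/= /pushforward.
  have -> : (fun s : R => c + a * s) @^-1` `]x, y] = `](x - c) / a, (y - c) / a]%classic.
    apply/seteqP; split => s /=; rewrite !in_itv/= ltr_pdivrMr// ler_pdivlMr//.
      by move=> /andP[h1 h2]; apply/andP; split; lra.
    by move=> /andP[h1 h2]; apply/andP; split; lra.
  rewrite !lebesgue_measure_itv/= !lte_fin ltr_pM2r ?invr_gt0// ltrD2r.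
  case: ifPn => // _; last by rewrite mule0.
  rewrite -!EFinD -EFinM; congr EFin; field; exact: lt0r_neq0.
rewrite /mu /= /mscale /= muleA -EFinM mulVf ?mul1e// gt_eqF//.
Qed.

Lemma taff_tbox n (c : 'rV[R]_n) a (A : 'I_n -> set R) :
  taff c a @^-1` tbox A = tbox (fun i => (fun s => c ord0 i + a * s) @^-1` A i).
Proof. by apply/seteqP; split => t /= At i; have := At i; rewrite tnth_mktuple. Qed.

Lemma lebn_affine n (c : 'rV[R]_n) (a : R) (X : set (n.-tuple R)) : 0 < a ->
  measurable X -> lebn n X = ((a ^+ n)%:E * pushforward (lebn n) (taff c a) X)%E.
Proof.
move=> a0.
have a10 : 0 <= a ^+ n by rewrite exprn_ge0// ltW.
apply: (@lebn_unique _ [the measure _ _ of mscale (NngNum a10)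
  (measure_function_pushforward__canonical__measure_function_Measure (lebn n)
    (measurable_taff c a))]) => A mA.
rewrite /= /mscale/= /pushforward taff_tbox lebn_tbox; last first.
  by move=> i; have := measurable_affine (c ord0 i) a measurableT (mA i); rewrite setTI.
rewrite (eq_bigr (fun i => a^-1%:E * lam (A i))%E); last first.
  by move=> i _; exact: lebesgue_measure_affine.
rewrite big_split/= muleA.
suff -> : ((a ^+ n)%:E * \prod_(i < n) (a^-1)%:E)%E = 1%E by rewrite mul1e.
rewrite prodEFin -EFinM big_const_ord iter_mulr_1 exprVn mulfV//.
by rewrite expf_neq0// gt_eqF.
Qed.

End lebn_measure.

(** * Integrals against [lebn] under slicing and scaling; volumes of balls *)

Section integral_lebn.
Variable R : realType.
Local Notation lam := (@lebesgue_measure R).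

Lemma integrable_le_cst d (T : measurableType d) (mu : {measure set T -> \bar R})
    (D : set T) (f : T -> R) (M : R) :
  measurable D -> (mu D < +oo)%E -> measurable_fun D f ->
  (forall x, D x -> `|f x| <= M) -> mu.-integrable D (EFin \o f).
Proof.
move=> mD Doo mf fM; apply: measurable_bounded_integrable => //.
exists M; split; first exact: num_real.
by move=> x Mx t Dt /=; apply: le_trans (fM _ Dt) (ltW Mx).
Qed.

Lemma integral_tins n (i : 'I_n.+1) (f : n.+1.-tuple R -> \bar R) :
  (lebn n.+1).-integrable setT f ->
  (\int[lebn n.+1]_t f t = \int[@lebsf R n]_t \int[lam]_s f (tins i (t, s)))%E.
Proof.
move=> fi.
have mf : measurable_fun setT f by exact: measurable_int fi.
pose nu := measure_function_pushforward__canonical__measure_function_Measure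
  (@lebsf R n \x lam)%E (measurable_tins i).
have E (g : n.+1.-tuple R -> \bar R) : (\int[lebn n.+1]_t g t = \int[nu]_t g t)%E.
  by apply: eq_measure_integral => A mA _; exact: lebn_tins.
have fi' : (@lebsf R n \x lam)%E.-integrable setT (f \o tins i).
  apply/integrableP; split; first by apply: measurableT_comp => //; exact: measurable_tins.
  have /integrableP[_] := fi; rewrite E /nu.
  rewrite (@ge0_integral_pushforward _ _ _ _ _ _ (measurable_tins i))//.
  exact: measurableT_comp.
rewrite E [LHS](integral_pushforward (measurable_tins i))//.
by rewrite preimage_setT -(integral12_prod_meas1 fi').
Qed.

Lemma ge0_integral_taff n (c : 'rV[R]_n) (a : R) (X : set (n.-tuple R))
    (f : n.-tuple R -> \bar R) : 0 < a -> measurable X -> measurable_fun X f ->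
  (forall t, X t -> (0 <= f t)%E) ->
  (\int[lebn n]_(t in X) f t =
   (a ^+ n)%:E * \int[lebn n]_(t in taff c a @^-1` X) f (taff c a t))%E.
Proof.
move=> a0 mX mf f0.
have a10 : 0 <= a ^+ n by rewrite exprn_ge0// ltW.
pose nu := measure_function_pushforward__canonical__measure_function_Measure (lebn n)
  (measurable_taff c a).
rewrite (eq_measure_integral [the measure _ _ of mscale (NngNum a10) nu]); last first.
  by move=> A mA _; exact: lebn_affine.
rewrite ge0_integral_mscale//=.
rewrite (ge0_integral_pushforward (measurable_taff c a))//.
by move=> t; rewrite inE => /f0.
Qed.

Lemma integral_taff n (c : 'rV[R]_n) (a : R) (X : set (n.-tuple R))
    (f : n.-tuple R -> \bar R) : 0 < a -> measurable X ->
  (lebn n).-integrable X f ->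
  (\int[lebn n]_(t in X) f t =
   (a ^+ n)%:E * \int[lebn n]_(t in taff c a @^-1` X) f (taff c a t))%E.
Proof.
move=> a0 mX fi.
have mf : measurable_fun X f by exact: measurable_int fi.
have [p q] : (\int[lebn n]_(t in X) f^\+ t \is a fin_num)%E /\
             (\int[lebn n]_(t in X) f^\- t \is a fin_num)%E.
  by split; apply: integrable_fin_num => //; [exact: integrable_funepos|exact: integrable_funeneg].
rewrite integralE [in RHS]integralE.
have Ep : (\int[lebn n]_(t in X) f^\+ t = (a ^+ n)%:E *
    \int[lebn n]_(t in taff c a @^-1` X) (f \o taff c a)^\+ t)%E.
  rewrite [X in (_ * X)%E](eq_integral (f^\+ \o taff c a)%E) => [|t _].
    by apply: ge0_integral_taff => //; exact: measurable_funepos.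
  by rewrite -funepos_comp.
have Eq : (\int[lebn n]_(t in X) f^\- t = (a ^+ n)%:E *
    \int[lebn n]_(t in taff c a @^-1` X) (f \o taff c a)^\- t)%E.
  rewrite [X in (_ * X)%E](eq_integral (f^\- \o taff c a)%E) => [|t _].
    by apply: ge0_integral_taff => //; exact: measurable_funeneg.
  by rewrite -funeneg_comp.
(* Distributing the factor over the difference in [\bar R] needs a finite term; dividing by [a ^+ n]
   transfers the finiteness of the negative part to the rescaled integral. *)
have ainv : ((a ^+ n)^-1%:E * (a ^+ n)%:E = 1 :> \bar R)%E.
  by rewrite -EFinM mulVf// expf_neq0// gt_eqF.
have qfin : (\int[lebn n]_(x in taff c a @^-1` X) (fun t => f (taff c a t))^\- x)%E \is a fin_num.
  have -> : (\int[lebn n]_(x in taff c a @^-1` X) (fun t => f (taff c a t))^\- x =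
      (a ^+ n)^-1%:E * \int[lebn n]_(t in X) f^\- t)%E.
    by rewrite Eq muleA ainv mul1e.
  by rewrite fin_numM.
rewrite muleBr//; first by rewrite Ep Eq.
by apply: fin_num_adde_defl; rewrite fin_numN.
Qed.

Lemma taff_eball n (x : 'rV[R]_n) (a : R) : 0 < a ->
  taff x a @^-1` [set t | eball x a (row_of t)] = [set t | eball 0 1 (row_of t)].
Proof.
move=> a0; apply/seteqP; split => t; rewrite /= /eball /= row_of_taff addrAC subrr add0r subr0.
  by rewrite enormZ gtr0_norm// -ltr_pdivlMl// mulVf// gt_eqF.
by rewrite enormZ gtr0_norm// -ltr_pdivlMl// mulVf// gt_eqF.
Qed.

Lemma lebn_eball_lty n : (lebn n [set t | eball (0 : 'rV[R]_n) 1 (row_of t)] < +oo)%E.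
Proof.
apply: (@le_lt_trans _ _ (lebn n (tbox (fun=> `](-1)%R, 1%R[%classic : set R)))).
  apply: le_measure; rewrite ?inE.
  - exact: measurable_eball.
  - exact: measurable_tbox.
  move=> t; rewrite /= /eball/= subr0 => t1 i; rewrite /= in_itv/= -ltr_norml.
  by have := enorm_coord (row_of t) i; rewrite mxE => /le_lt_trans; exact.
rewrite lebn_tbox//.
suff /fin_numPlt/andP[] :
  (\prod_(i < n) lam (`](-1)%R, 1%R[%classic : set R))%E \is a fin_num by [].
by apply: prode_fin_num => i _; rewrite lebesgue_measure_itv/=; case: ifP.
Qed.

(** The unit ball contains the cube of half-side [1 / (n + 1)]: squared norms there are at most
    [n / (n + 1)^2 < 1]. Taking [n + 1] rather than [n] also covers dimension 0. *)
Lemma ball_vol1_gt0 n : 0 < ball_vol n (1 : R).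
Proof.
have e0 : 0 < n.+1%:R^-1 :> R by rewrite invr_gt0.
rewrite /ball_vol -lte_fin fineK; last by rewrite ge0_fin_numE// lebn_eball_lty.
apply: (@lt_le_trans _ _
    (lebn n (tbox (fun=> `](- n.+1%:R^-1)%R, (n.+1%:R^-1)%R[%classic : set R)))).
  rewrite lebn_tbox//= lebesgue_measure_itv/= lte_fin gtrN// -EFinD opprK prodEFin lte_fin.
  by rewrite prodr_gt0// => i _; rewrite addr_gt0.
apply: le_measure; rewrite ?inE.
- exact: measurable_tbox.
- exact: measurable_eball.
move=> t tn; rewrite /= /eball/= subr0 -(ltr_pXn2r (n := 2))// ?nnegrE ?enorm_ge0// enorm_sqr.
apply: (@le_lt_trans _ _ (\sum_(i < n) n.+1%:R^-1 ^+ 2)).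
  apply: ler_sum => i _; rewrite mxE -real_normK ?num_real// ler_sqr ?nnegrE ?normr_ge0 ?(ltW e0)//.
  by have := tn i; rewrite /= in_itv/= -ltr_norml => /ltW.
rewrite sumr_const card_ord expr1n -[ltLHS]mulr_natr expr2 -mulrA.
have -> : n.+1%:R^-1 * n%:R = n%:R / n.+1%:R :> R by rewrite mulrC.
have h : n%:R / n.+1%:R < 1 :> R by rewrite ltr_pdivrMr// mul1r ltr_nat.
have h2 : n.+1%:R^-1 <= 1 :> R by rewrite invf_le1// ler1n.
by apply: le_lt_trans h; rewrite ler_piMl// divr_ge0.
Qed.

Lemma lebn_eball n (x : 'rV[R]_n) r : 0 < r ->
  lebn n [set t | eball x r (row_of t)] = (r ^+ n * ball_vol n (1 : R))%:E.
Proof.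
move=> r0; rewrite (@lebn_affine _ _ x r)//; last exact: measurable_eball.
rewrite /pushforward taff_eball// EFinM fineK//.
by rewrite ge0_fin_numE// lebn_eball_lty.
Qed.

Lemma ball_volE n r : 0 < r -> ball_vol n r = r ^+ n * ball_vol n (1 : R).
Proof. by move=> r0; rewrite {1}/ball_vol lebn_eball. Qed.

End integral_lebn.

(** * Chain rule along lines from continuous partial derivatives *)

Section chain_rule.
Variable R : realType.
Variable n : nat.
Implicit Types (f : 'rV[R]_n -> R) (y z v : 'rV[R]_n).

Local Notation e_ k := (delta_mx ord0 k : 'rV[R]_n).

Lemma is_derive_coord f y k (s : R) : derivable f (y + s *: e_ k) (e_ k) ->
  is_derive s 1 (fun s => f (y + s *: e_ k)) (partial k f (y + s *: e_ k)).
Proof.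
move=> df.
have E : (fun h : R => h^-1 *: (f (y + (h *: (1 : R) + s) *: e_ k) - f (y + s *: e_ k))) =
   (fun h : R => h^-1 *: (f (h *: e_ k + (y + s *: e_ k)) - f (y + s *: e_ k))).
  apply/funext => h; congr (_ *: (f _ - _)).
  by rewrite -[h *: 1]/(h * 1) mulr1 scalerDl addrCA.
by apply: DeriveDef; rewrite /derivable /derive /partial /shift /= E.
Qed.

(** The bound [|s| <= |t|] covers both signs of [t]: the mean value theorem is applied on [[0, t]]
    or on [[t, 0]]. *)
Lemma coord_MVT f y k (t : R) :
  (forall s, `|s| <= `|t| -> derivable f (y + s *: e_ k) (e_ k)) ->
  exists2 s, `|s| <= `|t| & f (y + t *: e_ k) - f y = t * partial k f (y + s *: e_ k).
Proof.
move=> df.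
have D (s : R) : `|s| <= `|t| ->
    is_derive s 1 (fun s => f (y + s *: e_ k)) (partial k f (y + s *: e_ k)).
  by move=> /df; exact: is_derive_coord.
have [t0|t0] := leP 0 t.
  have [||s] := @MVT_segment R (fun s => f (y + s *: e_ k))
      (fun s => partial k f (y + s *: e_ k)) 0 t t0.
  - by move=> s; rewrite in_itv/= => /andP[h1 h2]; apply: D; rewrite !ger0_norm// ltW.
  - apply: derivable_within_continuous => s; rewrite in_itv/= => /andP[h1 h2].
    have [] // : is_derive s 1 (fun s => f (y + s *: e_ k)) (partial k f (y + s *: e_ k)).
    by apply: D; rewrite !ger0_norm.
  rewrite in_itv/= => /andP[h1 h2] E; exists s; first by rewrite !ger0_norm.
  by move: E; rewrite scale0r addr0 subr0 mulrC.
have [||s] := @MVT_segment R (fun s => f (y + s *: e_ k))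
    (fun s => partial k f (y + s *: e_ k)) t 0 (ltW t0).
- by move=> s; rewrite in_itv/= => /andP[h1 h2]; apply: D; rewrite !ltr0_norm// lerN2 ltW.
- apply: derivable_within_continuous => s; rewrite in_itv/= => /andP[h1 h2].
  have [] // : is_derive s 1 (fun s => f (y + s *: e_ k)) (partial k f (y + s *: e_ k)).
  by apply: D; rewrite (ler0_norm h2) ltr0_norm// lerN2.
rewrite in_itv/= => /andP[h1 h2] E; exists s.
  by rewrite (ler0_norm h2) ltr0_norm// lerN2.
by move: E; rewrite scale0r addr0 sub0r mulrN => /eqP; rewrite -eqr_oppLR opprB mulrC => /eqP.
Qed.

(** The base point [w h] moves with [h] because directional increments are later split into
    successive axis steps. The mean value theorem turns the quotient into [c] times a partial
    derivative at a point near [z], and continuity concludes. *)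
Lemma cvg_partial_increment f z k (w : R -> 'rV[R]_n) (c : R) :
  (\forall y \near z, derivable f y (e_ k)) -> {for z, continuous (partial k f)} ->
  w h @[h --> 0^'] --> z ->
  h^-1 * (f (w h + (h * c) *: e_ k) - f (w h)) @[h --> 0^'] --> c * partial k f z.
Proof.
move=> df cf wz; apply/cvgrPdist_le => e e0.
(* This tolerance absorbs the factor [|c|] left by the mean value theorem; the extra 1 covers
   [c = 0]. *)
have e1 : 0 < e / (`|c| + 1) by rewrite divr_gt0// ltr_wpDl.
have : \forall y \near z, derivable f y (e_ k) /\
    `|partial k f z - partial k f y| < e / (`|c| + 1).
  by near=> y; split; near: y => //; move/cvgrPdist_lt : cf; apply.
move=> /nbhs_ballP[d /= d0 dP].
have d20 : 0 < d / 2 by rewrite divr_gt0.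
(* [r] bounds [|h|] so that the axis step [|h c|] is at most [d / 2]; the other [d / 2] is for the
   distance from [w h] to [z]. *)
have [r r0 rE] : exists2 r, 0 < r & r * (`|c| + 1) = d / 2.
  exists (d / 2 / (`|c| + 1)); first by rewrite divr_gt0// ltr_wpDl.
  by rewrite divfK// gt_eqF// ltr_wpDl.
near=> h.
have h0 : h != 0 by near: h; exact: nbhs_dnbhs_neq.
have hr : `|h| < r.
  near: h; apply: dnbhs0_lt => //.
have wh : `|z - w h| < d / 2 by near: h; move/cvgrPdist_lt : wz; apply.
have near_z s : `|s| <= `|h * c| -> ball z d (w h + s *: e_ k).
  move=> sh; rewrite -ball_normE /= opprD addrA.
  apply: le_lt_trans (ler_normB _ _) _; rewrite (splitr d); apply: ltr_leD => //.
  rewrite normrZ; apply: le_trans (_ : `|s| * 1 <= _).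
    apply: ler_wpM2l => //.
    rewrite [`|_|]mx_normrE; apply/bigmax_leP; split => //= -[i j] _ /=.
    by rewrite mxE; case: (_ && _); rewrite ?normr1 ?normr0.
  rewrite mulr1 -rE; apply: le_trans sh _; rewrite normrM.
  by apply: ler_pM => //; [exact: ltW|rewrite lerDl].
have [|s sh ->] := @coord_MVT f (w h) k (h * c).
  by move=> s /near_z/dP[].
rewrite -mulrA mulKf// -mulrBr normrM.
have [_ /ltW] := dP _ (near_z s sh).
move=> /(ler_wpM2l (normr_ge0 c))/le_trans; apply.
rewrite mulrA ler_pdivrMr ?ltr_wpDl// mulrC.
by apply: ler_wpM2l; [exact: ltW|rewrite lerDl].
Unshelve. all: by end_near. Qed.

(** Telescoping, by induction over an arbitrary list of axes: adding the axis [k] moves from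
    [z + h u] to [z + h u + (h v_k) e_k], where [u] gathers the axes already treated. *)
Lemma cvg_dir_increment f z v :
  (forall k, \forall y \near z, derivable f y (e_ k)) ->
  (forall k, {for z, continuous (partial k f)}) ->
  h^-1 * (f (z + h *: v) - f z) @[h --> 0^'] --> \sum_k v ord0 k * partial k f z.
Proof.
move=> df cf.
suff H (s : seq 'I_n) :
    h^-1 * (f (z + h *: \sum_(k <- s) v ord0 k *: e_ k) - f z) @[h --> 0^'] -->
    \sum_(k <- s) v ord0 k * partial k f z.
  have := H (index_enum 'I_n).
  have <- : v = \sum_(k <- index_enum 'I_n) v ord0 k *: e_ k by exact: row_sum_delta.
  by [].
elim: s => [|k s ih].
  rewrite !big_nil; under eq_fun do rewrite scaler0 addr0 subrr mulr0.
  exact: cvg_cst.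
rewrite !big_cons.
set u := \sum_(k <- s) _ in ih *.
have -> : (fun h : R => h^-1 * (f (z + h *: (v ord0 k *: e_ k + u)) - f z)) =
  (fun h : R => h^-1 * (f (z + h *: u + (h * v ord0 k) *: e_ k) - f (z + h *: u)) +
                h^-1 * (f (z + h *: u) - f z)).
  apply/funext => h; rewrite -mulrDr; congr (_ * _); rewrite addrA subrK; congr (f _ - _).
  by rewrite scalerDr scalerA addrA addrAC.
apply: cvgD ih; apply: cvg_partial_increment => //.
rewrite -[X in _ --> X]addr0; apply: cvgD; first exact: cvg_cst.
rewrite -(scale0r u); apply: cvgZl.
exact: cvg_within.
Qed.

Lemma is_derive_line f z v (s : R) :
  (forall k, \forall y \near (z + s *: v), derivable f y (e_ k)) ->
  (forall k, {for (z + s *: v), continuous (partial k f)}) ->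
  is_derive s 1 (fun s => f (z + s *: v)) (\sum_k v ord0 k * partial k f (z + s *: v)).
Proof.
move=> df cf.
have H := @cvg_dir_increment f _ v df cf.
have E : (fun h : R => h^-1 *: (f (z + (h *: (1 : R) + s) *: v) - f (z + s *: v))) =
   (fun h : R => h^-1 * (f (z + s *: v + h *: v) - f (z + s *: v))).
  apply/funext => h; congr (_ *: (f _ - _)).
  by rewrite -[h *: 1]/(h * 1) mulr1 scalerDl addrA addrAC.
apply: DeriveDef; rewrite /derivable /derive /shift /= E; first by apply/cvg_ex; eexists; exact: H.
exact/cvg_lim.
Qed.

End chain_rule.

(** * The fundamental theorem on segments; compactness of closed balls and bounds on them *)

Section closed_balls.
Variable R : realType.

Lemma FTC_itvcc (F f : R -> R) (a b : R) : a < b ->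
  (forall s, a <= s <= b -> is_derive s 1 F (f s)) ->
  (forall s, a <= s <= b -> {for s, continuous f}) ->
  (\int[lebesgue_measure]_(s in `[a, b]) (f s)%:E = (F b - F a)%:E)%E.
Proof.
move=> ab dF cf; rewrite EFinB; apply: continuous_FTC2 => //.
- apply: continuous_in_subspaceT => s; rewrite inE /= in_itv/= => sab.
  exact: cf.
- have /(continuous_within_itvP _ ab)[_ Fa Fb] : {within `[a, b], continuous F}.
    apply: derivable_within_continuous => s; rewrite in_itv/= => /dF dFs.
    exact: ex_derive.
  split => // s; rewrite in_itv/= => /andP[h1 h2].
  have dFs : is_derive s 1 F (f s) by apply: dF; rewrite !ltW.
  exact: ex_derive.
- move=> s; rewrite in_itv/= => /andP[h1 h2].
  have dFs : is_derive s 1 F (f s) by apply: dF; rewrite !ltW.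
  by rewrite derive1E; exact: derive_val.
Qed.

(** A point of the sphere is approached by shrinking it towards [x]. This turns the hypothesis on
    the closure of the ball into membership in [D] for every [y] with [enorm (y - x) <= r]. *)
Lemma closure_eball n (x y : 'rV[R]_n) r : 0 < r -> enorm (y - x) <= r ->
  closure (eball x r) y.
Proof.
move=> r0 yr B /nbhs_ballP[e /= e0 eB].
have N0 := normr_ge0 (y - x).
have eN0 : 0 < e + `|y - x| by rewrite ltr_wpDr.
(* The shrunk point is at sup-norm distance [t * |y - x| < e] from [y], and [t] stays positive and
   meaningful when [y = x]. *)
pose t := e / (e + `|y - x|).
have t0 : 0 < t by rewrite divr_gt0.
have t1 : t <= 1 by rewrite ler_pdivrMr// mul1r lerDl.
exists (x + (1 - t) *: (y - x)); split.
  rewrite /eball /= addrAC subrr add0r enormZ ger0_norm ?subr_ge0//.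
  have [->|N1] := eqVneq (enorm (y - x)) 0; first by rewrite mulr0.
  have N2 : 0 < enorm (y - x) by rewrite lt0r N1 enorm_ge0.
  by apply: lt_le_trans yr; rewrite gtr_pMl// ltrBlDr ltrDl.
apply: eB; rewrite -ball_normE /=.
have -> : y - (x + (1 - t) *: (y - x)) = t *: (y - x).
  by apply/rowP => j; rewrite !mxE; ring.
rewrite normrZ gtr0_norm// /t mulrAC ltr_pdivrMr// ltr_pM2l//.
by rewrite ltrDr.
Qed.

(** Coordinates are bounded by the Euclidean norm, so the closure lies in a sup-norm closed ball. *)
Lemma compact_closure_eball n (x : 'rV[R]_n) r : 0 < r ->
  compact (closure (eball x r)).
Proof.
move=> r0; apply: bounded_closed_compact; last exact: closed_closure.
have : closure (eball x r) `<=` closed_ball x r.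
  rewrite -closure_ballE; apply: closureS => y; rewrite /eball/= => yx.
  rewrite -ball_normE/= distrC [`|_|]mx_normrE.
  apply/bigmax_ltP; split => //= -[i j] _ /=; rewrite (ord1 i).
  exact: le_lt_trans (enorm_coord _ _) yx.
rewrite closed_ballE// => sub; exists (`|x| + r); split; first exact: num_real.
move=> M xM y /sub; rewrite /closed_ball_ /= => yx.
rewrite (le_trans _ (ltW xM))//.
have -> : y = x - (x - y) by rewrite opprB addrCA subrr addr0.
by apply: le_trans (ler_normB _ _) _; rewrite lerD2l.
Qed.

Lemma bounded_on_closed_eball n (x : 'rV[R]_n) r (D : set 'rV[R]_n)
    (f : 'rV[R]_n -> R) : 0 < r -> closure (eball x r) `<=` D ->
  (forall y, D y -> {for y, continuous f}) ->
  exists M, forall y, enorm (y - x) <= r -> `|f y| <= M.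
Proof.
move=> r0 xrD cf.
have : compact (f @` closure (eball x r)).
  apply: continuous_compact; last exact: compact_closure_eball.
  by apply: continuous_in_subspaceT => y; rewrite inE => /xrD; exact: cf.
move=> /compact_bounded[M [_ HM]]; exists (M + 1) => y yx.
by apply: (HM (M + 1)); [rewrite ltrDl|exists y => //; exact: closure_eball].
Qed.

(** Measurability jointly in the scale and the point is what Fubini on [[0, rho]] times the unit
    ball requires. *)
Lemma measurable_row_affine n (x : 'rV[R]_n) (D : set 'rV[R]_n) (f : 'rV[R]_n -> R) :
  open D -> (forall y, D y -> {for y, continuous f}) ->
  measurable_fun setT (fun p : (measurableTypeR R * n.-tuple R)%type =>
    (f \_ D) (x + p.1 *: row_of p.2)).
Proof.
move=> oD cf.
pose phi (p : (measurableTypeR R * n.-tuple R)%type) : n.-tuple R := taff x p.1 p.2.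
have -> : (fun p : (measurableTypeR R * n.-tuple R)%type => (f \_ D) (x + p.1 *: row_of p.2)) =
    (fun t => (f \_ D) (row_of t)) \o phi.
  by apply/funext => p /=; rewrite /phi row_of_taff.
apply: measurableT_comp; first exact: measurable_row_continuous.
apply/measurable_fun_tnthP => j; rewrite /phi /comp.
under eq_fun do rewrite tnth_mktuple.
apply: measurable_funD => //; apply: measurable_funM; first exact: measurable_fst.
by apply: (measurableT_comp (f := @tnth n R ^~ j)); [exact: measurable_tnth|exact: measurable_snd].
Qed.

Lemma measurable_row_affine1 n (x : 'rV[R]_n) (l : R) (D : set 'rV[R]_n) (f : 'rV[R]_n -> R) :
  open D -> (forall y, D y -> {for y, continuous f}) ->
  measurable_fun setT (fun t : n.-tuple R => (f \_ D) (x + l *: row_of t)).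
Proof.
move=> oD cf.
have -> : (fun t : n.-tuple R => (f \_ D) (x + l *: row_of t)) =
    (fun t => (f \_ D) (row_of t)) \o taff x l.
  by apply/funext => t /=; rewrite row_of_taff.
apply: measurableT_comp; first exact: measurable_row_continuous.
exact: measurable_taff.
Qed.

End closed_balls.

(** * Mean value property of harmonic functions on solid balls *)

Section mean_value.
Variable R : realType.
Variable n : nat.
Variable D : set 'rV[R]_n.+1.
Variable u : 'rV[R]_n.+1 -> R.
Hypothesis oD : open D.
Hypothesis hu : is_harmonic D u.
Variables (x : 'rV[R]_n.+1) (r : R).
Hypothesis r0 : 0 < r.
Hypothesis xrD : closure (eball x r) `<=` D.

Local Notation lam := (@lebesgue_measure R).
Local Notation B1 := [set t : n.+1.-tuple R | eball 0 1 (row_of t)].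

Let inD (l : R) y : 0 <= l <= r -> enorm y <= 1 -> D (x + l *: y).
Proof.
move=> /andP[l0 lr] y1; apply: xrD; apply: closure_eball => //.
rewrite addrAC subrr add0r enormZ ger0_norm//.
by rewrite (le_trans (ler_wpM2l l0 y1))// mulr1.
Qed.

Let inball (l : R) y : 0 <= l <= r -> enorm y <= 1 -> enorm (x + l *: y - x) <= r.
Proof.
move=> /andP[l0 lr] y1; rewrite addrAC subrr add0r enormZ ger0_norm//.
by rewrite (le_trans (ler_wpM2l l0 y1))// mulr1.
Qed.

Let cu y : D y -> {for y, continuous u}.
Proof. by move=> Dy; have [/(_ _ Dy)[]] := hu. Qed.

Let cu1 i y : D y -> {for y, continuous (partial i u)}.
Proof. by move=> Dy; have [/(_ _ Dy)[_ /(_ i)[_ []]]] := hu. Qed.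

Let cu2 i j y : D y -> {for y, continuous (partial j (partial i u))}.
Proof. by move=> Dy; have [/(_ _ Dy)[_ /(_ i)[_ [_ /(_ j)[]]]]] := hu. Qed.

Let du y : D y -> forall k, \forall z \near y, derivable u z (delta_mx ord0 k).
Proof.
move=> Dy k; apply: filterS (open_nbhs_nbhs (conj oD Dy)) => z Dz.
by have [/(_ _ Dz)[_ /(_ k)[]]] := hu.
Qed.

Let du1 i y : D y -> forall k, \forall z \near y, derivable (partial i u) z (delta_mx ord0 k).
Proof.
move=> Dy k; apply: filterS (open_nbhs_nbhs (conj oD Dy)) => z Dz.
by have [/(_ _ Dz)[_ /(_ i)[_ [_ /(_ k)[]]]]] := hu.
Qed.

Let line_cont (f : 'rV[R]_n.+1 -> R) (z v : 'rV[R]_n.+1) (s : R) :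
  {for z + s *: v, continuous f} -> {for s, continuous (fun s : R => f (z + s *: v))}.
Proof.
move=> cf; apply: continuous_comp; last exact: cf.
by apply: cvgD; [exact: cvg_cst|apply: cvgZl; exact: cvg_id].
Qed.

Let mB1 : measurable B1. Proof. exact: measurable_eball. Qed.

Let B1fin : (lebn n.+1 B1 < +oo)%E. Proof. exact: lebn_eball_lty. Qed.

(** For [v (y) = u (x + l y)] this is the chord integrand of [v] divided by [l], each derivative of
    [v] bringing out a factor [l]; in this form it makes sense at [l = 0] too. *)
Definition flux i (l : R) (y : 'rV[R]_n.+1) : R :=
  (partial i u \_ D) (x + l *: y) * y ord0 i +
  l * (partial i (partial i u) \_ D) (x + l *: y) * ((\sum_k y ord0 k ^+ 2 - 1) / 2).

Lemma measurable_flux i l : measurable_fun setT (fun t : n.+1.-tuple R => flux i l (row_of t)).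
Proof.
apply: measurable_funD.
  apply: measurable_funM; last exact: measurable_row_coord.
  by apply: measurable_row_affine1 => //; exact: cu1.
apply: measurable_funM.
  apply: measurable_funM => //.
  by apply: measurable_row_affine1 => //; exact: cu2.
apply: measurable_funM => //; apply: measurable_funB => //.
apply: measurable_sum => k; apply: measurable_funX; exact: measurable_row_coord.
Qed.

Lemma integrable_flux i l : 0 <= l <= r ->
  (lebn n.+1).-integrable B1 (EFin \o (fun t => flux i l (row_of t))).
Proof.
move=> lr.
have [M1 HM1] := bounded_on_closed_eball r0 xrD (@cu1 i).
have [M2 HM2] := bounded_on_closed_eball r0 xrD (@cu2 i i).
(* On the unit ball [|y_i| <= 1] and [|(|y|^2 - 1) / 2| <= 1], while [l <= r]. *)
apply: (@integrable_le_cst _ _ _ _ _ _ (M1 + r * M2)) => //.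
  exact: measurable_funTS (measurable_flux i l).
move=> t; rewrite /eball/= subr0 => /ltW t1.
have /andP[l0 lr'] := lr.
rewrite /flux !patchE !mem_set//; [|exact: inD..].
apply: le_trans (ler_normD _ _) _; apply: lerD.
  rewrite normrM -[leRHS]mulr1; apply: ler_pM => //; first by apply: HM1; exact: inball.
  exact: le_trans (enorm_coord _ _) t1.
rewrite -mulrA normrM; apply: ler_pM => //; first by rewrite ger0_norm.
rewrite normrM -[leRHS]mulr1; apply: ler_pM => //; first by apply: HM2; exact: inball.
rewrite -enorm_sqr.
have : enorm (row_of t) ^+ 2 <= 1 by rewrite expr_le1// enorm_ge0.
have := sqr_ge0 (enorm (row_of t)).
by rewrite ler_norml => h1 h2; apply/andP; split; lra.
Qed.

Lemma row_of_tins i (t : n.-tuple R) (s : R) :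
  row_of (tins i (t, s)) = row_of (tins i (t, 0)) + s *: delta_mx ord0 i.
Proof.
apply/rowP => j; rewrite !mxE !tnth_mktuple /=.
case: (unliftP i j) => [k ->|->]; rewrite ?eqxx ?mulr1 ?add0r//.
by rewrite eq_sym (negbTE (neq_lift _ _)) mulr0 addr0.
Qed.

Lemma sum_sqr_tins i (t : n.-tuple R) (s : R) :
  \sum_k row_of (tins i (t, s)) ord0 k ^+ 2 = \sum_k tnth t k ^+ 2 + s ^+ 2.
Proof.
rewrite (bigD1_ord i)//= addrC; congr (_ + _).
  by apply: eq_bigr => k _; rewrite mxE tnth_mktuple liftK.
by rewrite mxE tnth_mktuple unlift_none.
Qed.

(* On the chord of the unit ball parallel to the i-th axis, flux i l is the derivative of
   s |-> (d_i u) (s^2 - h^2) / 2, which vanishes at both ends s = h and s = - h. *)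
Lemma integral_flux_slice i l (t : n.-tuple R) : 0 <= l <= r ->
  (\int[lam]_s ((EFin \o (fun t => flux i l (row_of t))) \_ B1) (tins i (t, s)) = 0)%E.
Proof.
move=> lr; set q := \sum_k tnth t k ^+ 2.
have inB (s : R) : B1 (tins i (t, s)) <-> q + s ^+ 2 < 1.
  rewrite /eball/= subr0 -(ltr_pXn2r (n := 2))// ?nnegrE ?enorm_ge0//.
  by rewrite enorm_sqr sum_sqr_tins expr1n.
(* [q] is the squared distance from the centre to the line of the chord: for [q >= 1] the line
   misses the open ball, otherwise [h] below is half the length of the chord. *)
have [q1|q1] := leP 1 q.
  apply: integral0_eq => s _; rewrite patchE; case: ifPn => //.
  rewrite inE => /inB qs; exfalso; have := sqr_ge0 (s : R); lra.
pose h := Num.sqrt (1 - q).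
have h0 : 0 < h by rewrite sqrtr_gt0 subr_gt0.
have h2 : h ^+ 2 = 1 - q by rewrite sqr_sqrtr// subr_ge0 ltW.
have -> : (fun s => ((EFin \o (fun t => flux i l (row_of t))) \_ B1) (tins i (t, s))) =
    ((fun s => (flux i l (row_of (tins i (t, s))))%:E) \_ `]-h, h[).
  apply/funext => s; rewrite !patchE; congr (if _ then _ else _).
  apply/idP/idP.
    rewrite inE => /inB qs; rewrite inE /= in_itv/= -ltr_norml.
    rewrite -(ltr_pXn2r (n := 2))// ?nnegrE ?(ltW h0)// real_normK ?num_real//; lra.
  rewrite inE /= in_itv/= -ltr_norml => sh; rewrite inE; apply/inB.
  move: sh; rewrite -(ltr_pXn2r (n := 2))// ?nnegrE ?(ltW h0)// real_normK ?num_real//; lra.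
(* The fundamental theorem works on the closed segment; the endpoints are negligible, and they still
   map into [D] because [inD] allows [enorm y <= 1]. *)
rewrite -integral_mkcond -(integral_itv_bndoo true false); last first.
  apply/measurable_EFinP; apply: measurable_funTS.
  apply: (measurableT_comp (measurable_flux i l)).
  apply: (measurableT_comp (measurable_tins i)).
  exact: measurable_fun_pair.
pose z := x + l *: row_of (tins i (t, 0)).
pose v := l *: delta_mx ord0 i : 'rV[R]_n.+1.
have zD s : - h <= s <= h -> D (z + s *: v).
  rewrite -ler_norml => sh.
  have -> : z + s *: v = x + l *: row_of (tins i (t, s)).
    by rewrite row_of_tins scalerDr addrA /v !scalerA mulrC.
  apply: inD => //; rewrite -(ler_pXn2r (n := 2))// ?nnegrE ?enorm_ge0//.
  rewrite enorm_sqr sum_sqr_tins expr1n.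
  have : `|s| ^+ 2 <= h ^+ 2 by rewrite ler_pXn2r// nnegrE// ltW.
  rewrite real_normK ?num_real// -/q; lra.
pose g s := partial i u (z + s *: v) * s +
  (l * partial i (partial i u) (z + s *: v)) * ((s ^+ 2 - h ^+ 2) / 2).
transitivity (\int[lam]_(s in `[(- h)%R, h]) (g s)%:E)%E.
  apply: eq_integral => s; rewrite inE/= in_itv/= => sh; congr EFin.
  rewrite /flux sum_sqr_tins -/q.
  have <- : z + s *: v = x + l *: row_of (tins i (t, s)).
    by rewrite [in RHS]row_of_tins scalerDr addrA /v !scalerA mulrC.
  rewrite !patchE !mem_set; [|exact: zD..].
  rewrite /g mxE tnth_mktuple unlift_none h2 /=; congr (_ + _ * _); lra.
pose F s := partial i u (z + s *: v) * ((s ^+ 2 - h ^+ 2) / 2).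
have -> : (0 = (F h - F (- h))%:E)%E by rewrite /F sqrrN subrr mul0r !mulr0 subrr.
apply: FTC_itvcc.
- lra.
- move=> s sh.
  have d1 := @is_derive_line _ _ (partial i u) z v s
    (du1 i (zD _ sh)) (fun k => @cu2 i k _ (zD _ sh)).
  have d2 : is_derive s 1 (fun s : R => (s ^+ 2 - h ^+ 2) / 2) s.
    have -> : (fun s : R => (s ^+ 2 - h ^+ 2) / 2) = 2^-1 \*: ((@id R) ^+ 2 - cst (h ^+ 2)).
      by apply/funext => a; rewrite /= mulrC.
    by apply: is_derive_eq; rewrite /GRing.scale/=; field.
  have d3 : is_derive s 1 F _ := is_deriveM d1 d2.
  apply: (is_derive_eq d3); rewrite /g /=; congr (_ + _).
  rewrite (bigD1 i)//= big1 => [|k ki]; last first.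
    by rewrite !mxE eqxx (negbTE ki) mulr0 mul0r.
  by rewrite !mxE !eqxx mulr1 addr0 /GRing.scale/= mulrC.
- move=> s sh; apply: cvgD.
    apply: cvgM; last exact: cvg_id.
    by apply: (@line_cont (partial i u)); exact: cu1 (zD _ sh).
  apply: cvgM.
    apply: cvgM; first exact: cvg_cst.
    by apply: (@line_cont (partial i (partial i u))); exact: cu2 (zD _ sh).
  apply: cvgM; last exact: cvg_cst.
  apply: cvgB; last exact: cvg_cst.
  exact: exprn_continuous.
Qed.

Lemma integral_flux i l : 0 <= l <= r ->
  (\int[lebn n.+1]_(t in B1) (flux i l (row_of t))%:E = 0)%E.
Proof.
move=> lr; rewrite integral_mkcond (@integral_tins _ _ i).
  by rewrite integral0_eq// => t _; exact: integral_flux_slice.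
by have /(integrable_mkcond _ mB1) := integrable_flux i lr.
Qed.

(** Wherever [x + l y] lies in [D], this is the derivative of [u (x + l y)] in [l]. *)
Definition radial (l : R) (y : 'rV[R]_n.+1) : R :=
  \sum_i (partial i u \_ D) (x + l *: y) * y ord0 i.

(** In the sum of [flux i l] over [i], the second-order terms share the factor [l (|y|^2 - 1) / 2],
    so they add up to a multiple of the Laplacian of [u]. *)
Lemma integral_radial l : 0 <= l <= r ->
  (\int[lebn n.+1]_(t in B1) (radial l (row_of t))%:E = 0)%E.
Proof.
move=> lr.
transitivity (\int[lebn n.+1]_(t in B1) \sum_(i < n.+1) (flux i l (row_of t))%:E)%E.
  apply: eq_integral => t; rewrite inE /eball/= subr0 => /ltW t1.
  rewrite sumEFin; congr EFin; rewrite big_split/= -[LHS]addr0; congr (_ + _).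
  have xD : D (x + l *: row_of t) by exact: inD.
  rewrite -mulr_suml -mulr_sumr [X in l * X](_ : _ = 0) ?mulr0 ?mul0r//.
  have [_ /(_ _ xD) lap0] := hu; rewrite -[RHS]lap0.
  by apply: eq_bigr => i _; rewrite patchE mem_set.
rewrite integral_sum//; last by move=> i; exact: integrable_flux.
by rewrite big1// => i _; exact: integral_flux.
Qed.

Lemma integral_radial_segment rho (y : 'rV[R]_n.+1) : 0 < rho <= r -> enorm y <= 1 ->
  (\int[lam]_(l in `[0%R, rho]) (radial l y)%:E = (u (x + rho *: y) - u x)%:E)%E.
Proof.
move=> /andP[rho0 rhor] y1.
have lD l : 0 <= l <= rho -> D (x + l *: y).
  by move=> /andP[l0 lr]; apply: inD => //; rewrite l0 (le_trans lr).
pose g l := \sum_i y ord0 i * partial i u (x + l *: y).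
transitivity (\int[lam]_(l in `[0%R, rho]) (g l)%:E)%E.
  apply: eq_integral => l; rewrite inE/= in_itv/= => /lD xD; congr EFin.
  by apply: eq_bigr => i _; rewrite patchE mem_set// mulrC.
pose F l := u (x + l *: y).
have -> : u (x + rho *: y) - u x = F rho - F 0 by rewrite /F scale0r addr0.
apply: FTC_itvcc => // l lr.
  by apply: is_derive_line; [exact: du (lD _ lr)|move=> k; exact: cu1 (lD _ lr)].
rewrite /g /prop_for /continuous_at /=.
apply: (cvg_big add_continuous) => i _; apply: cvgM; first exact: cvg_cst.
by apply: (@line_cont (partial i u)); exact: cu1 (lD _ lr).
Qed.

(** [radial] is integrated over [[0, rho]] times the unit ball in both orders: [l] first gives the
    increments [u (x + rho y) - u x], [y] first gives 0. *)
Lemma mean_value_unit rho : 0 < rho <= r ->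
  (\int[lebn n.+1]_(t in B1) (u (x + rho *: row_of t))%:E =
   (ball_vol n.+1 (1 : R) * u x)%:E)%E.
Proof.
move=> rr; have /andP[rho0 rhor] := rr.
pose Q : set (measurableTypeR R * n.+1.-tuple R) := `[0%R, rho]%classic `*` B1.
have mQ : measurable Q by apply: measurableX => //.
pose f (p : measurableTypeR R * n.+1.-tuple R) := radial p.1 (row_of p.2).
have mf : measurable_fun setT f.
  apply: measurable_sum => i; apply: measurable_funM.
    by apply: measurable_row_affine => //; exact: cu1.
  apply: (measurableT_comp (f := fun t : n.+1.-tuple R => row_of t ord0 i)).
    exact: measurable_row_coord.
  exact: measurable_snd.
have [M HM] := choice (fun i => bounded_on_closed_eball r0 xrD (@cu1 i)).
have fQ : (lam \x @lebsf R n.+1)%E.-integrable Q (EFin \o f).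
  apply: (@integrable_le_cst _ _ _ _ _ _ (\sum_i M i)) => //.
  - have E : ((lam \x @lebsf R n.+1) Q = lam `[0%R, rho]%classic * @lebsf R n.+1 B1)%E.
      exact: product_measure1E.
    rewrite [ltLHS]E lte_mul_pinfty//.
    by rewrite lebesgue_measure_itv/=; case: ifP.
  - exact: measurable_funTS.
  move=> [l t] [/=]; rewrite in_itv/= => /andP[l0 lrho]; rewrite /eball/= subr0 => /ltW t1.
  have lr : 0 <= l <= r by rewrite l0 (le_trans lrho).
  apply: le_trans (ler_norm_sum _ _ _) _; apply: ler_sum => i _.
  rewrite normrM -[leRHS]mulr1; apply: ler_pM => //.
    by rewrite patchE mem_set; [apply: HM; exact: inball|exact: inD].
  exact: le_trans (enorm_coord _ _) t1.
have fT : (lam \x @lebsf R n.+1)%E.-integrable setT ((EFin \o f) \_ Q).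
  by have /(integrable_mkcond _ mQ) := fQ.
have fub := Fubini fT.
have E1 : (\int[@lebsf R n.+1]_t \int[lam]_l ((EFin \o f) \_ Q) (l, t) =
   \int[lebn n.+1]_(t in B1) (u (x + rho *: row_of t) - u x)%:E)%E.
  rewrite [RHS]integral_mkcond; apply: eq_integral => t _.
  rewrite [RHS]patchE; case: ifPn => [|/negP tB].
    rewrite inE => tB.
    rewrite -integral_radial_segment//; last by move: tB; rewrite /eball/= subr0 => /ltW.
    rewrite [RHS]integral_mkcond; apply: eq_integral => l _.
    rewrite !patchE; congr (if _ then _ else _).
    by apply/idP/idP; rewrite !inE => // -[].
  apply: integral0_eq => l _; rewrite patchE; case: ifPn => //.
  by rewrite inE => -[_ /= tB']; exfalso; apply: tB; rewrite inE.
have E0 : (\int[lam]_l \int[@lebsf R n.+1]_t ((EFin \o f) \_ Q) (l, t) = 0)%E.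
  apply: integral0_eq => l _.
  have [lr|lr] := boolP (0 <= (l : R) <= rho).
    have /andP[l0 l1] := lr.
    rewrite -(@integral_radial l); last by rewrite l0 (le_trans l1).
    rewrite [RHS]integral_mkcond; apply: eq_integral => t _.
    rewrite !patchE; congr (if _ then _ else _).
    apply/idP/idP; rewrite !inE; first by case.
    by split => //=; rewrite in_itv.
  apply: integral0_eq => t _; rewrite patchE; case: ifPn => //.
  by rewrite inE => -[/= +]; rewrite in_itv/= (negbTE lr).
have [M0 HM0] := bounded_on_closed_eball r0 xrD cu.
have mu : measurable_fun setT (fun t : n.+1.-tuple R => (u \_ D) (x + rho *: row_of t)).
  by apply: measurable_row_affine1 => //; exact: cu.
have rrr : 0 <= rho <= r by rewrite rhor ltW.
have ui : (lebn n.+1).-integrable B1 (fun t => (u (x + rho *: row_of t))%:E).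
  apply: (@integrable_le_cst _ _ _ _ _ _ M0) => //.
    apply: eq_measurable_fun (measurable_funTS mu) => t; rewrite inE /eball/= subr0 => /ltW t1.
    by rewrite patchE mem_set//; exact: inD.
  by move=> t; rewrite /eball/= subr0 => /ltW t1; apply: HM0; exact: inball.
have ci : (lebn n.+1).-integrable B1 (fun t => (u x)%:E).
  by apply: (@integrable_le_cst _ _ _ _ _ _ `|u x|).
move: fub; rewrite E0 E1; under eq_integral do rewrite EFinB.
have -> : (ball_vol n.+1 (1 : R) * u x)%:E = (\int[lebn n.+1]_(t in B1) (u x)%:E)%E.
  by rewrite integral_cst//= lebn_eball// expr1n mul1r -EFinM mulrC.
rewrite integralB//=.
(* In [\bar R], a zero difference is turned into an equality by first reducing to finite values. *)
have := integrable_fin_num mB1 ui; have := integrable_fin_num mB1 ci.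
case: (\int[lebn n.+1]_(_ in _) (u x)%:E)%E => [a| |]//.
case: (\int[lebn n.+1]_(t in _) (u (x + _))%:E)%E => [b| |]// _ _.
by rewrite -EFinB => -[/esym/eqP]; rewrite subr_eq0 => /eqP ->.
Qed.

Lemma mean_value rho : 0 < rho <= r ->
  (\int[lebn n.+1]_(t in [set t | eball x rho (row_of t)]) (u (row_of t))%:E =
   (rho ^+ n.+1 * ball_vol n.+1 (1 : R) * u x)%:E)%E.
Proof.
move=> rr; have /andP[rho0 rhor] := rr.
have [M0 HM0] := bounded_on_closed_eball r0 xrD cu.
rewrite (integral_taff x rho0); first last.
- apply: (@integrable_le_cst _ _ _ _ _ _ M0) => //.
  + exact: measurable_eball.
  + by rewrite lebn_eball// ltry.
  + apply: eq_measurable_fun (measurable_funTS (measurable_row_continuous oD cu)) => t.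
    rewrite inE /eball/= => tr; rewrite patchE mem_set//; apply: xrD.
    by apply: closure_eball => //; rewrite (le_trans (ltW tr)).
  by move=> t; rewrite /eball/= => tr; apply: HM0; rewrite (le_trans (ltW tr)).
- exact: measurable_eball.
rewrite taff_eball//; under eq_integral do rewrite row_of_taff.
by rewrite mean_value_unit// -EFinM mulrA.
Qed.

End mean_value.

(** * One-dimensional integrals of powers *)

Section powers.
Variable R : realType.
Local Notation lam := (@lebesgue_measure R).

Lemma powR_continuous_at (p s : R) : 0 < s -> {for s, continuous (fun a : R => a `^ p)}.
Proof.
move=> s0; apply: differentiable_continuous; apply/derivable1_diffP.
by apply: derivable_powR; rewrite in_itv/= s0.
Qed.

(** [d > 0] keeps the segment away from a possible singularity at 0, and keeping [p] under the
    integral avoids dividing by it. The constant [k] will be a value of the weight [W]. *)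
Lemma integral_powR_segment (k p d r : R) : 0 < d -> d < r ->
  (\int[lam]_(s in `]d, r[) (k * (p * s `^ (p - 1)))%:E = (k * (r `^ p - d `^ p))%:E)%E.
Proof.
move=> d0 dr.
have mf : measurable_fun setT (fun s : R => k * (p * s `^ (p - 1))).
  by apply: measurable_funM => //; apply: measurable_funM => //; exact: measurable_powR.
rewrite -(integral_itv_bndoo true false); last first.
  by apply/measurable_EFinP; exact: measurable_funTS.
pose F s := k * s `^ p.
have -> : k * (r `^ p - d `^ p) = F r - F d by rewrite /F mulrBr.
apply: FTC_itvcc => // s /andP[ds sr].
  have s0 : 0 < s by exact: lt_le_trans ds.
  have d1 := is_derive1_powR p s0.
  have -> : F = k \*: (fun a : R => a `^ p) by [].
  by apply: is_derive_eq.
have s0 : 0 < s by exact: lt_le_trans ds.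
apply: cvgM; first exact: cvg_cst.
apply: cvgM; first exact: cvg_cst.
exact: powR_continuous_at.
Qed.

(** The integrand is unbounded at 0 when [q < 1], so the interval is exhausted by []d k, r[] and
    monotone convergence applies. *)
Lemma integral_powR_0 (q r : R) : 0 < q -> 0 < r ->
  (\int[lam]_(s in `]0%R, r[) (s `^ (q - 1))%:E = (r `^ q / q)%:E)%E.
Proof.
move=> q0 r0.
have q1 : q != 0 by rewrite gt_eqF.
(* [k + 2] rather than [k + 1] makes [d 0 < r] strict. *)
pose d (k : nat) := r / k.+2%:R.
have d0 k : 0 < d k by rewrite divr_gt0.
have dr k : d k < r by rewrite ltr_pdivrMr// ltr_pMr// ltr1n.
have dle k l : (k <= l)%N -> d l <= d k.
  by move=> kl; rewrite ler_pM2l// lef_pV2 ?posrE// ler_nat.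
have mf : measurable_fun setT (fun s : R => s `^ (q - 1)) by exact: measurable_powR.
have E : `]0%R, r[%classic = \bigcup_k `]d k, r[%classic.
  apply/seteqP; split => s /=; last first.
    by move=> [k _] /=; rewrite !in_itv/= => /andP[h1 ->]; rewrite (lt_trans _ h1).
  rewrite in_itv/= => /andP[s0 sr].
  exists (Num.trunc (r / s)) => //=; rewrite in_itv/= sr andbT ltr_pdivrMr// mulrC -ltr_pdivrMr//.
  apply: lt_trans (Num.Theory.truncnS_gt _) _; by rewrite ltr_nat.
have C : (\int[lam]_(s in `]d k, r[) (s `^ (q - 1))%:E)%E @[k --> \oo] -->
    (\int[lam]_(s in `]0%R, r[) (s `^ (q - 1))%:E)%E.
  rewrite E; apply: ge0_nondecreasing_set_cvg_integral.
  - move=> k l kl; apply/subsetPset => s /=; rewrite !in_itv/= => /andP[h1 ->].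
    by rewrite (le_lt_trans _ h1)// dle.
  - by move=> k; exact: measurable_itv.
  - by move=> k; apply/measurable_EFinP; exact: measurable_funTS.
  - by move=> k s _; rewrite lee_fin powR_ge0.
apply: (cvg_unique _ C) => //.
have -> : (fun k => \int[lam]_(s in `]d k, r[) (s `^ (q - 1))%:E)%E =
    (fun k => (q^-1 * (r `^ q - d k `^ q))%:E).
  apply/funext => k; rewrite -integral_powR_segment//.
  by apply: eq_integral => s _; rewrite mulKf.
apply: cvg_EFin; first exact: nearW.
have -> : r `^ q / q = q^-1 * (r `^ q - 0) by rewrite subr0 mulrC.
apply: cvgM; first exact: cvg_cst.
apply: cvgB; first exact: cvg_cst.
have /cvg_at_rightP := powR_cvg0 q0; apply; split => //.
rewrite -[X in _ --> X](mulr0 r); apply: cvgM; first exact: cvg_cst.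
have := @cvg_harmonic R; rewrite -cvg_shiftS; exact.
Qed.

End powers.

(** * Layer-cake formula for power weights *)

Section layer_cake.
Variables (R : realType) (n : nat).
Local Notation lam := (@lebesgue_measure R).
Local Notation m := n.+1.
Implicit Types x : 'rV[R]_m.

Definition center x : set (m.-tuple R) := [set t | enorm (row_of t - x) = 0].

Lemma measurable_center x : measurable (center x).
Proof.
rewrite -[X in measurable X]setTI.
have -> : center x = (fun t => enorm (row_of t - x)) @^-1` [set 0] by [].
exact: measurable_enorm.
Qed.

Lemma lebn_center x : lebn m (center x) = 0%E.
Proof.
apply/eqP; rewrite -measure_le0.
have -> : (0 = lebn m (tbox (fun i => [set x ord0 i])) :> \bar R)%E.
  by rewrite lebn_tbox// big_ord_recl lebesgue_measure_set1 mul0e.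
apply: le_measure; rewrite ?inE.
- exact: measurable_center.
- exact: measurable_tbox.
move=> t /= t0 i /=; have := enorm_coord (row_of t - x) i.
by rewrite t0 normr_le0 !mxE subr_eq0 => /eqP.
Qed.

(** [W] stands for [u] extended by zero, with [c = |B_1| u x], or for the constant 1 when bare
    integrability of the kernel is wanted. Harmonicity enters only through [Wc]. *)
Variables (x : 'rV[R]_m) (r p c M : R) (W : m.-tuple R -> R).
Hypotheses (r0 : 0 < r) (pm : 0 < p + m%:R).
Hypothesis mW : measurable_fun setT W.
Hypothesis WM : forall t, eball x r (row_of t) -> `|W t| <= M.
Hypothesis Wc : forall rho, 0 < rho < r ->
  (\int[lebn m]_(t in [set t | eball x rho (row_of t)]) (W t)%:E = (rho ^+ m * c)%:E)%E.

Local Notation B rho := [set t : m.-tuple R | eball x rho (row_of t)].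
Local Notation dist t := (enorm (row_of t - x)).

(* The center is excluded because there [0 `^ p = 0], so that the layer-cake formula fails
   for [p < 0]. *)
Let Q : set (m.-tuple R * measurableTypeR R) := [set ts | 0 < dist ts.1 /\ dist ts.1 < ts.2 < r].

Let mdist : measurable_fun setT (fun ts : m.-tuple R * measurableTypeR R => dist ts.1).
Proof.
apply: (measurableT_comp (f := fun t => dist t)); first exact: measurable_enorm.
exact: measurable_fst.
Qed.

Let mQ : measurable Q.
Proof.
have -> : Q = (fun ts => dist ts.1) @^-1` `]0%R, +oo[ `&`
    ((fun ts => ts.2 - dist ts.1) @^-1` `]0%R, +oo[ `&` snd @^-1` `]-oo, r[).
  apply/seteqP; split => ts; rewrite /Q /= !in_itv/= !andbT subr_gt0.
    by move=> [-> /andP[-> ->]].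
  by move=> [-> [-> ->]].
apply: measurableI; last apply: measurableI; rewrite -[X in measurable X]setTI.
- exact: mdist.
- by apply: measurable_funB => //; exact: measurable_snd.
- exact: (@measurable_snd _ _ (m.-tuple R) (measurableTypeR R)).
Qed.

Let f (ts : m.-tuple R * measurableTypeR R) : R := W ts.1 * (p * (ts.2 : R) `^ (p - 1)).

Let mf : measurable_fun setT f.
Proof.
apply: measurable_funM.
  by apply: (measurableT_comp (f := W)) => //; exact: measurable_fst.
apply: measurable_funM => //.
apply: (measurableT_comp (f := fun s : R => s `^ (p - 1))); first exact: measurable_powR.
exact: measurable_snd.
Qed.

Let mfs (s : R) : measurable_fun setT (fun t => f (t, s)).
Proof. by rewrite /f /=; apply: measurable_funM => //; exact: measurable_cst. Qed.

Let g := (EFin \o f) \_ Q.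

Let mg : measurable_fun setT g.
Proof.
by apply/(measurable_restrictT _ mQ); apply/measurable_EFinP; exact: measurable_funTS.
Qed.

Let mBC s : measurable (B s `\` center x).
Proof. by apply: measurableD; [exact: measurable_eball|exact: measurable_center]. Qed.

Let QE t (s : R) : Q (t, s) <-> 0 < s < r /\ (B s `\` center x) t.
Proof.
rewrite /Q /eball/= /center/=; split.
  move=> [d0 /andP[ds sr]]; split; last by split => // dt0; rewrite dt0 ltxx in d0.
  by rewrite sr (lt_trans d0 ds).
move=> [/andP[s0 sr] [ds /eqP d0]]; split; last by rewrite ds.
by rewrite lt0r d0 enorm_ge0.
Qed.

(** Used with [h = abse] for the integrability of [g] and with [h = id] for the value of its
    integral. *)
Let sliceE (s : R) (h : \bar R -> \bar R) : h 0%E = 0%E ->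
  (\int[@lebsf R m]_t h (g (t, s)) = ((fun s =>
     \int[lebn m]_(t in B s `\` center x) h (f (t, s))%:E) \_ `]0%R, r[) s)%E.
Proof.
move=> h0; rewrite [RHS]patchE; have [sr|sr] := boolP (0 < s < r).
  rewrite mem_set; last by rewrite /= in_itv.
  rewrite [RHS]integral_mkcond.
  apply: eq_integral => t _; rewrite /g !patchE.
  have [tQ|tQ] := pselect (Q (t, s)).
    by have /QE[_ tB] := tQ; rewrite !mem_set.
  rewrite !memNset// => tB; apply: tQ; exact/QE.
rewrite memNset; last by rewrite /= in_itv; exact/negP.
apply: integral0_eq => t _; rewrite /g patchE memNset// => /QE[sr' _].
by rewrite sr' in sr.
Qed.

Let powm (s : R) : 0 < s -> s ^+ m * s `^ (p - 1) = s `^ ((p + m%:R) - 1).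
Proof.
move=> s0; rewrite -powR_mulrn ?ltW// -powRD; last by rewrite (gt_eqF s0) implybT.
by congr (_ `^ _); ring.
Qed.

(** By Tonelli: the slice at [s] has absolute integral at most
    [M |p| s^(p - 1) |B_s| = K s^(p + m - 1)], which is integrable at 0 because [p + m > 0]. *)
Let g_integrable : (@lebsf R m \x lam)%E.-integrable setT g.
Proof.
apply/integrable21ltyP => //.
(* The bound is evaluated at the centre of the ball. *)
have M0 : 0 <= M.
  have := WM (t := [tuple x ord0 i | i < m]).
  have -> : row_of [tuple x ord0 i | i < m] = x by apply/rowP => i; rewrite !mxE tnth_mktuple.
  rewrite /eball/= subrr.
  have -> : enorm (0 : 'rV[R]_m) = 0.
    by have := enormZ 0 (0 : 'rV[R]_m); rewrite scale0r normr0 mul0r.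
  by move=> /(_ r0); apply: le_trans.
pose K := M * `|p| * ball_vol m (1 : R).
have K0 : 0 <= K by rewrite !mulr_ge0// ltW// ball_vol1_gt0.
apply: (@le_lt_trans _ _ (\int[lam]_(s in `]0%R, r[) (K%:E * (s `^ ((p + m%:R) - 1))%:E))%E).
  rewrite [leRHS]integral_mkcond.
  have m1 : measurable_fun setT (fun s : R => (K%:E * (s `^ ((p + m%:R) - 1))%:E)%E).
    apply: emeasurable_funM => //; apply/measurable_EFinP; exact: measurable_powR.
  apply: ge0_le_integral => //.
  - by move=> s _; exact: integral_ge0.
  - apply: (@measurable_fun_fubini_tonelli_G _ _ _ _ _ (@lebsf R m) (abse \o g)).
      exact: measurableT_comp.
    by move=> ts; exact: abse_ge0.
  - have mI : measurable (`]0%R, r[%classic : set R) by [].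
    by apply/(measurable_restrictT _ mI); exact: measurable_funTS.
  move=> s _; rewrite (@sliceE s abse) ?abse0//.
  rewrite !patchE; case: ifPn => //; rewrite inE/= in_itv/= => /andP[s0 sr].
  apply: (@le_trans _ _ (\int[lebn m]_(t in B s `\` center x)
     (cst (M * (`|p| * s `^ (p - 1)))%:E t))%E).
    apply: ge0_le_integral => //=.
      apply/measurable_EFinP; apply: measurable_funTS.
      exact: measurableT_comp (mfs s).
    move=> t [tB _]; rewrite lee_fin /f/= !normrM; apply: ler_pM => //.
      by apply: WM; exact: lt_trans tB sr.
    by rewrite (ger0_norm (powR_ge0 _ _)).
  rewrite integral_cst//.
  apply: (@le_trans _ _ ((M * (`|p| * s `^ (p - 1)))%:E * lebn m (B s))%E).
    apply: lee_wpmul2l; first by rewrite lee_fin !mulr_ge0// powR_ge0.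
    by apply: le_measure; rewrite ?inE//; exact: measurable_eball.
  rewrite lebn_eball// -!EFinM lee_fin -powm// /K; lra.
rewrite ge0_integralZl//.
- by rewrite integral_powR_0// -EFinM ltry.
- by apply/measurable_EFinP; apply: measurable_funTS; exact: measurable_powR.
- by move=> s _; rewrite lee_fin powR_ge0.
Qed.

Let kern (t : m.-tuple R) : R := W t * (r `^ p - dist t `^ p).

Let mkern : measurable_fun setT kern.
Proof.
apply: measurable_funM => //; apply: measurable_funB => //.
apply: (measurableT_comp (f := fun s : R => s `^ p)); first exact: measurable_powR.
exact: measurable_enorm.
Qed.

Let innerE t : (\int[lam]_s g (t, s) = ((EFin \o kern) \_ (B r `\` center x)) t)%E.
Proof.
rewrite [RHS]patchE; case: ifPn => [|/negP tB].
  rewrite inE => -[tr /eqP t0].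
  have d0 : 0 < dist t by rewrite lt0r t0 enorm_ge0.
  rewrite /= /kern -integral_powR_segment// [RHS]integral_mkcond.
  apply: eq_integral => s _; rewrite /g !patchE; congr (if _ then _ else _).
  apply/idP/idP; rewrite !inE /Q /= in_itv/=; first by case.
  by move=> ->.
apply: integral0_eq => s _; rewrite /g patchE memNset//.
move=> [d0 /andP[ds sr]]; apply: tB; rewrite inE; split => /=.
  exact: lt_trans ds sr.
by move=> t0; move: d0; rewrite /= t0 ltxx.
Qed.

(** Off the centre, the kernel is the inner integral of the integrable [g]; the centre is a null
    set. *)
Lemma layer_cake_integrable :
  (lebn m).-integrable (B r) (fun t => (W t * (r `^ p - dist t `^ p))%:E).
Proof.
have I1 : (lebn m).-integrable (B r `\` center x) (EFin \o kern).
  apply/(integrable_mkcond _ (mBC r)).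
  have -> : (EFin \o kern) \_ (B r `\` center x) = fubini_F lam g.
    by apply/funext => t; rewrite -innerE.
  exact: integrable_fubini_F g_integrable.
have mk : measurable_fun (B r) (EFin \o kern).
  by apply/measurable_EFinP; exact: measurable_funTS.
apply/integrableP; split => //.
rewrite (ge0_negligible_integral (measurable_center x))//.
- by have /integrableP[] := I1.
- exact: measurable_eball.
- exact: measurableT_comp.
- exact: lebn_center.
Qed.

(** After the exchange the slice at [s] contributes [p s^(p - 1) s^m c] by [Wc], and integrating
    [s^(p + m - 1)] over []0, r[] yields the factor [1 / (p + m)]. *)
Lemma layer_cake :
  (\int[lebn m]_(t in B r) (W t * (r `^ p - dist t `^ p))%:E =
   (p / (p + m%:R) * c * r `^ (p + m%:R))%:E)%E.
Proof.
rewrite (negligible_integral (measurable_center x) _ layer_cake_integrable); last 2 first.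
- exact: measurable_eball.
- exact: lebn_center.
transitivity (\int[@lebsf R m]_t \int[lam]_s g (t, s))%E.
  rewrite [LHS]integral_mkcond; apply: eq_integral => t _.
  by rewrite innerE.
rewrite (Fubini g_integrable).
transitivity (\int[lam]_(s in `]0%R, r[) ((p * c)%:E * (s `^ ((p + m%:R) - 1))%:E))%E.
  rewrite [RHS]integral_mkcond; apply: eq_integral => s _.
  rewrite (@sliceE s id)// !patchE; case: ifPn => //.
  rewrite inE/= in_itv/= => /andP[s0 sr].
  have Wi : (lebn m).-integrable (B s) (EFin \o W).
    apply: (@integrable_le_cst _ _ _ _ _ _ M).
    + exact: measurable_eball.
    + by rewrite lebn_eball// ltry.
    + exact: measurable_funTS.
    + by move=> t tB; apply: WM; exact: lt_trans tB sr.
  have Wi' : (lebn m).-integrable (B s `\` center x) (EFin \o W).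
    by apply: integrableS Wi => //; exact: measurable_eball.
  transitivity (\int[lebn m]_(t in B s `\` center x) ((p * s `^ (p - 1))%:E * (W t)%:E))%E.
    by apply: eq_integral => t _; rewrite /f -EFinM mulrC.
  rewrite integralZl//.
  rewrite -(negligible_integral (measurable_center x) _ Wi); last 2 first.
  - exact: measurable_eball.
  - exact: lebn_center.
  by rewrite Wc ?s0// -!EFinM -powm//; congr EFin; ring.
have Pi : lam.-integrable `]0%R, r[%classic (fun s : R => (s `^ ((p + m%:R) - 1))%:E).
  apply/integrableP; split.
    by apply/measurable_EFinP; apply: measurable_funTS; exact: measurable_powR.
  have := ltry (r `^ (p + m%:R) / (p + m%:R)); rewrite -integral_powR_0//.
  apply: le_lt_trans; rewrite le_eqVlt; apply/orP; left; apply/eqP.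
  by apply: eq_integral => s _; rewrite gee0_abs// lee_fin powR_ge0.
rewrite integralZl// integral_powR_0// -EFinM; congr EFin; ring.
Qed.

End layer_cake.

(** * Weighted means of harmonic functions and integrability over bounded domains *)

Section weighted_mean_value.
Variables (R : realType) (n : nat).
Local Notation m := n.+1.

Lemma enormBC (x y : 'rV[R]_m) : enorm (x - y) = enorm (y - x).
Proof. by rewrite -opprB enormN. Qed.

(** The layer-cake formula with [c = |B_1| u x], divided by [|B_r| = r^m |B_1|]. Integrability is
    recorded as well, since changing the sign under the integral will require it. *)
Lemma weighted_mean_value (D : set 'rV[R]_m) (u : 'rV[R]_m -> R) (x : 'rV[R]_m) (r p : R) :
  open D -> is_harmonic D u -> 0 < r -> closure (eball x r) `<=` D -> 0 < p + m%:R ->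
  (lebn m).-integrable [set t | eball x r (row_of t)]
    (fun t => (u (row_of t) * (r `^ p - enorm (x - row_of t) `^ p))%:E) /\
  (((ball_vol m r)^-1)%:E * \int[lebn m]_(t in [set t | eball x r (row_of t)])
    (u (row_of t) * (r `^ p - enorm (x - row_of t) `^ p))%:E =
   (p / (p + m%:R) * r `^ p * u x)%:E)%E.
Proof.
move=> oD hu r0 xrD pm.
have cu y : D y -> {for y, continuous u} by move=> Dy; have [/(_ _ Dy)[]] := hu.
have [M HM] := bounded_on_closed_eball r0 xrD cu.
pose W (t : m.-tuple R) := (u \_ D) (row_of t).
have WE (rho : R) t : rho <= r -> eball x rho (row_of t) -> W t = u (row_of t).
  move=> rr tB; rewrite /W patchE mem_set//; apply: xrD; apply: closure_eball => //.
  exact: le_trans (ltW tB) rr.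
have mW : measurable_fun setT W by exact: measurable_row_continuous.
have WM t : eball x r (row_of t) -> `|W t| <= M.
  by move=> tB; rewrite (WE r)//; apply: HM; exact: ltW.
have Wc rho : 0 < rho < r ->
    (\int[lebn m]_(t in [set t | eball x rho (row_of t)]) (W t)%:E =
     (rho ^+ m * (ball_vol m (1 : R) * u x))%:E)%E.
  move=> /andP[rho0 rhor]; rewrite mulrA -(mean_value oD hu r0 xrD); last by rewrite rho0 ltW.
  by apply: eq_integral => t; rewrite inE => tB; rewrite (WE rho)// ltW.
have mB := measurable_eball x r.
have WuE t : t \in [set t : m.-tuple R | eball x r (row_of t)] ->
   (W t * (r `^ p - enorm (row_of t - x) `^ p))%:E =
   (u (row_of t) * (r `^ p - enorm (x - row_of t) `^ p))%:E.
  by rewrite inE => tB; rewrite (WE r t (lexx r) tB) (enormBC x).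
split.
  apply: (eq_integrable mB _ _ WuE).
  exact: layer_cake_integrable r0 pm mW WM.
rewrite -(eq_integral _ _ WuE) (layer_cake r0 pm mW WM Wc) ball_volE// -EFinM; congr EFin.
have v0 : ball_vol m (1 : R) != 0 by rewrite gt_eqF// ball_vol1_gt0.
have rm0 : r ^+ m != 0 by rewrite expf_neq0// gt_eqF.
rewrite powRD; last by rewrite (gt_eqF r0) implybT.
rewrite powR_mulrn ?ltW//; field.
by rewrite v0 rm0 nat1r (lt0r_neq0 pm).
Qed.

(** Enclose [A] in a ball of radius [rho] about [x]; the layer cake with [W = 1] handles
    [rho^p - |x - y|^p] there, and the constant [r^p - rho^p] corrects the radius. *)
Lemma integrable_dist_powR (x : 'rV[R]_m) (r p : R) (A : set 'rV[R]_m) :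
  open A -> bounded_set A -> 0 < p + m%:R ->
  (lebn m).-integrable [set t | A (row_of t)]
    (fun t => (r `^ p - enorm (x - row_of t) `^ p)%:E).
Proof.
move=> oA [K [_ AK]] pm.
have [rho rho0 Arho] : exists2 rho, 0 < rho & forall t : m.-tuple R,
    A (row_of t) -> eball x rho (row_of t).
  pose L := `|K| + 1 + `|x|.
  have L0 : 0 < L by rewrite /L ltr_wpDr// ltr_wpDl.
  (* A sup norm at most [L] gives a squared Euclidean norm at most [m L^2 < (L m + 1)^2]. *)
  exists (L * m%:R + 1); first by rewrite ltr_wpDl// mulr_ge0// ltW.
  move=> t tA; rewrite /eball/=.
  have tL : `|row_of t - x| <= L.
    apply: le_trans (ler_normB _ _) _; rewrite lerD2r; apply: (AK (`|K| + 1)) => //.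
    by rewrite ltr_pwDr// ler_norm.
  have LmE : 0 <= L * m%:R + 1 by rewrite addr_ge0// mulr_ge0// ltW.
  rewrite -(ltr_pXn2r (n := 2))// ?nnegrE ?enorm_ge0// enorm_sqr.
  apply: (@le_lt_trans _ _ (\sum_(i < m) L ^+ 2)).
    apply: ler_sum => i _; rewrite -real_normK ?num_real// ler_sqr ?nnegrE ?(ltW L0)//.
    apply: le_trans tL; rewrite [leRHS]mx_normrE.
    by apply/bigmax_geP; right => /=; exists (ord0, i).
  rewrite sumr_const card_ord -[ltLHS]mulr_natr.
  have m1 : 1 <= m%:R :> R by rewrite ler1n.
  rewrite [ltRHS]sqrrD exprMn expr1n mulr1.
  have h1 : L ^+ 2 * m%:R <= L ^+ 2 * m%:R ^+ 2.
    by rewrite ler_wpM2l ?sqr_ge0// expr2 ler_peMr.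
  have h2 : 0 <= L * m%:R *+ 2 by rewrite mulrn_wge0// mulr_ge0// ltW.
  by rewrite (le_lt_trans h1)// -addrA ltrDl ltr_wpDl.
have mB := measurable_eball x rho.
have mA := measurable_row_open oA.
have I1 : (lebn m).-integrable [set t | eball x rho (row_of t)]
    (fun t => (1 * (rho `^ p - enorm (row_of t - x) `^ p))%:E).
  apply: (@layer_cake_integrable _ _ x rho p 1 (fun=> 1)) => //.
  by move=> t _; rewrite normr1.
have I2 : (lebn m).-integrable [set t | eball x rho (row_of t)]
    (EFin \o cst (r `^ p - rho `^ p)).
  apply: (@integrable_le_cst _ _ _ _ _ _ `|r `^ p - rho `^ p|) => //.
  by rewrite lebn_eball// ltry.
apply: (@integrableS _ _ _ _ [set t | eball x rho (row_of t)]) => //.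
have := integrableD mB I1 I2.
apply: eq_integrable => // t _; rewrite /= -EFinD enormBC; congr EFin; ring.
Qed.

End weighted_mean_value.

Theorem theorem4 (R : realType) (m : nat) (hm : (2 <= m)%N) :
  (forall (D : set 'rV[R]_m) (u : 'rV[R]_m -> R),
     is_domain D -> is_harmonic D u ->
     forall (x : 'rV[R]_m) (r : R), D x -> 0 < r -> closure (eball x r) `<=` D ->
     (forall a : R, 0 < a < m%:R ->
        ((m%:R / a - 1) * r `^ (a - m%:R) * u x)%:E =
        (((ball_vol m r)^-1)%:E *
         \int[lebn m]_(t in [set t | eball x r (row_of t)])
           (u (row_of t) * (enorm (x - row_of t) `^ (a - m%:R) - r `^ (a - m%:R)))%:E)%E)
     /\
     (forall b : R, 0 < b ->
        ((1 - m%:R / (m%:R + b)) * r `^ b * u x)%:E =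
        (((ball_vol m r)^-1)%:E *
         \int[lebn m]_(t in [set t | eball x r (row_of t)])
           (u (row_of t) * (r `^ b - enorm (x - row_of t) `^ b))%:E)%E))
  /\
  (forall (x : 'rV[R]_m) (r a b : R) (A : set 'rV[R]_m),
     0 < r -> 0 < a < m%:R -> 0 < b ->
     is_domain A -> bounded_set A ->
     (lebn m).-integrable [set t | A (row_of t)]
        (fun t => (enorm (x - row_of t) `^ (a - m%:R) - r `^ (a - m%:R))%:E)
     /\
     (lebn m).-integrable [set t | A (row_of t)]
        (fun t => (r `^ b - enorm (x - row_of t) `^ b)%:E)).
Proof.
case: m hm => [//|n] _; split.
  move=> D u [_ [oD _]] hu x r _ r0 xrD; split => [a /andP[a0 am]|b b0].
    have pm : 0 < a - n.+1%:R + n.+1%:R by rewrite subrK.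
    have [I E] := weighted_mean_value oD hu r0 xrD pm.
    (* With [p = a - m] one has [p / (p + m) = 1 - m / a], so both sides of the first formula are
       the opposites of those of the weighted mean value. *)
    transitivity (- (((ball_vol n.+1 r)^-1)%:E *
      \int[lebn n.+1]_(t in [set t | eball x r (row_of t)])
        (u (row_of t) * (r `^ (a - n.+1%:R) - enorm (x - row_of t) `^ (a - n.+1%:R)))%:E))%E.
      rewrite E subrK -EFinN; congr EFin; field; exact: lt0r_neq0.
    rewrite -muleN -integralN.
      congr (_ * _)%E; apply: eq_integral => t _; rewrite -EFinN; congr EFin; ring.
    apply: fin_num_adde_defl; rewrite fin_numN.
    have mB := measurable_eball x r.
    by apply: integrable_fin_num => //; exact: integrable_funeneg.
  (* With [p = b], [p / (p + m) = 1 - m / (m + b)]. *)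
  have pm : 0 < b + n.+1%:R by rewrite addr_gt0.
  have [_ ->] := weighted_mean_value oD hu r0 xrD pm.
  congr EFin; rewrite [n.+1%:R + b]addrC; field.
  by rewrite nat1r (lt0r_neq0 pm).
move=> x r a b A r0 /andP[a0 am] b0 [_ [oA _]] bA; split.
  have mA := measurable_row_open oA.
  have pm : 0 < a - n.+1%:R + n.+1%:R by rewrite subrK.
  have := integrableN (integrable_dist_powR x r oA bA pm).
  by apply: eq_integrable => // t _; rewrite /= opprB.
by apply: integrable_dist_powR => //; rewrite addr_gt0.
Qed.
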